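(* Let $\mu_0\in\mathcal{A}(\Omega_0)$ for a compact set $\Omega_0\subseteq\mathcal{D}$. Let the policies $\{\mu_i\}$, the value functions $\{V^{\mu_i}\}$ and the regions $\{\Omega_i\}$ be generated by invariantly admissible policy iteration (described in the context), with $V^{\mu_i}\in\mathcal{C}^1(\Omega_i)$ and with $(\Omega_{i+1},c_i)$, $c_i>0$, determined at each step $i$ such that $$\Omega_{i+1}=\bar\Omega_{c_i}^{\mu_i}\quad\text{and}\quad \bar\Omega_{c_i}^{\mu_i}\subseteq\Omega_i .$$ Then for all $i\in\{0,1,2,\dots\}$: 1. $\mu_{i+1}$ is a policy on $\Omega_{i+1}$; 2. $\mu_i$ and $\mu_{i+1}$ are invariantly admissible on $\Omega_{i+1}$; 3. $V^{\mu_{i+1}}(x)\le V^{\mu_i}(x)\le\cdots\le V^{\mu_0}(x)$ for all $x\in\Omega_{i+1}$, and $0<V^{\mu_{i+1}}(x)$ for all $x\in\Omega_{i+1}\setminus\{0\}$.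
   Context: Setting: $\mathcal{D}\subseteq\mathbb{R}^n$ is the domain of $f$ and $g$ and contains a neighborhood of the origin; $f:\mathcal{D}\to\mathbb{R}^n$ with $f(0)=0$ and $g:\mathcal{D}\to\mathbb{R}^{n\times m}$ are locally Lipschitz continuous. The system is $\dot x=f(x)+g(x)u$, $x(0)=x_0\in\mathcal{D}$. The cost is $r(x,u)=Q(x)+u^TRu$, where $R\in\mathbb{R}^{m\times m}$ is a symmetric positive definite matrix and $Q:\mathcal{D}\to\mathbb{R}_+$ is positive definite on $\mathcal{D}$ (continuous, $Q(0)=0$, $Q(x)>0$ for $x\neq0$). All subsets of $\mathbb{R}^n$ (or $\mathcal{D}$) considered are assumed to contain a neighborhood of the origin and, without loss of generality, to have no region or point isolated from the origin. Policies: a function $\mu:\mathcal{D}\to\mathbb{R}^m$ is a policy on $\Omega\subseteq\mathcal{D}$ if $\mu$ is continuous on $\Omega$ and $\mu(0)=0$. Standing assumption: for any given policy $\mu$ (including all $\mu_i$), $f+g\mu$ is locally Lipschitz continuous on $\mathcal{D}$. $\phi(t;x_0,\mu)$ denotes the trajectory of $\dot x=f(x)+g(x)\mu(x)$ with $x(0)=x_0$. The trajectory is feasible on $\Omega$ if $x_0\in\Omega$ implies $\phi(t;x_0,\mu)\in\mathcal{D}$ for all $t\ge0$. $\mu$ asymptotically stabilizes the system on $\Omega$ if $\phi(t;x_0,\mu)$ exists for all $x_0\in\Omega$, $t\ge 0$; the equilibrium $0$ of $\dot x=f+g\mu$ is stable; and $\lim_{t\to\infty}\phi(t;x_0,\mu)=0$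 for all $x_0\in\Omega$. Value function: $V^\mu(x_0)=\int_0^\infty r(\phi(\tau;x_0,\mu),\mu(\phi(\tau;x_0,\mu)))\,d\tau$ for every $x_0\in\mathcal{D}$ for which it exists. $V^\mu\in\mathcal{C}^1(\Omega)$ means its gradient (column vector) $\nabla V^\mu$ exists at each point of $\Omega$ and is continuous on $\Omega$. For $c_i>0$, $\bar\Omega_{c_i}^{\mu_i}:=\{x\in\mathbb{R}^n:V^{\mu_i}(x)\le c_i\}$ (a compact set, consisting of those points where $V^{\mu_i}$ exists and is at most $c_i$). Admissibility: $\mu\in\mathcal{A}(\Omega)$ ($\mu$ is admissible on $\Omega$) iff $\mu$ is a policy on $\Omega$ that asymptotically stabilizes the system on $\Omega$, $\phi(t;x_0,\mu)$ is feasible on $\Omega$, and $V^\mu(x_0)<\infty$ for all $x_0\in\Omega$. $\mu$ is invariantly admissible on $\bar\Omega\subseteq\mathcal{D}$ (containing a neighborhood of the origin) iff $\mu\in\mathcal{A}(\bar\Omega)$ and $x_0\in\bar\Omega$ implies $\phi(t;x_0,\mu)\in\bar\Omega$ for all $t\ge0$. Invariantly admissible policy iteration: start from $\mu_0\in\mathcal{A}(\Omega_0)$, $\Omega_0\subseteq\mathcal{D}$ compact. For $i=0,1,2,\dots$: (policy evaluation) take the value function $V^{\mu_i}\in\mathcal{C}^1(\Omega_i)$ of $\mu_i$, which satisfies $(\nabla V^{\mu_i}(x))^T(f(x)+g(x)\mu_i(x))=-r(x,\mu_i(x))$ for all $x\in\Omega_i$; the $\mathcal{C}^1$ property is the assumption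 that whenever $\mu_i\in\mathcal{A}(\Omega_i)$, $V^{\mu_i}$ is continuously differentiable on $\Omega_i$; (policy improvement) take $\mu_{i+1}:\mathcal{D}\to\mathbb{R}^m$ with $\mu_{i+1}(x)=-\frac12R^{-1}g^T(x)\nabla V^{\mu_i}(x)$ for all $x\in\Omega_i$; (region update) take the next region $\Omega_{i+1}$, here determined by the rule stated in the claim. *)

(* Defs.v *)
From HB Require Import structures.
From mathcomp Require Import all_boot all_order all_algebra.
From mathcomp Require Import all_classical all_reals all_analysis.

Set Implicit Arguments.
Unset Strict Implicit.
Unset Printing Implicit Defensive.

Import Order.TTheory GRing.Theory Num.Theory.
Import numFieldNormedType.Exports.

Local Open Scope classical_set_scope.
Local Open Scope ring_scope.

(* Functions that the mathematics defines on the domain D only (f, g, Q and the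
   policies) are total functions here; no definition depends on their values
   outside D, because a trajectory is required to stay in D. *)

(* "No region or point isolated from the origin" is connectedness. *)
Definition region (R : realType) (n : nat) (D Omega : set 'cV[R]_n) : Prop :=
  [/\ Omega `<=` D, nbhs (0 : 'cV[R]_n) Omega & connected Omega].

Definition closed_loop (R : realType) (n m : nat)
    (f : 'cV[R]_n -> 'cV[R]_n) (g : 'cV[R]_n -> 'M[R]_(n, m))
    (mu : 'cV[R]_n -> 'cV[R]_m) (x : 'cV[R]_n) : 'cV[R]_n :=
  f x + g x *m mu x.

(* phi solves x' = F x, x 0 = x0 on [0, +oo[ inside D, the derivative at t = 0
   being one-sided; the values of phi at negative times are irrelevant. *)
Definition is_trajectory (R : realType) (n : nat) (D : set 'cV[R]_n)
    (F : 'cV[R]_n -> 'cV[R]_n) (x0 : 'cV[R]_n) (phi : R -> 'cV[R]_n) : Prop :=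
  [/\ phi 0 = x0,
      forall t : R, 0 <= t -> D (phi t),
      forall t : R, 0 < t -> is_derive t 1 phi (F (phi t)) &
      h^-1 *: (phi h - phi 0) @[h --> 0^'+] --> F (phi 0)].

Definition trajectory_exists (R : realType) (n : nat) (D : set 'cV[R]_n)
    (F : 'cV[R]_n -> 'cV[R]_n) (x0 : 'cV[R]_n) : Prop :=
  exists phi, is_trajectory D F x0 phi.

(* A chosen solution. When F is locally Lipschitz on D it is unique on
   [0, +oo[; the value is meaningless unless trajectory_exists D F x0. *)
Definition trajectory (R : realType) (n : nat) (D : set 'cV[R]_n)
    (F : 'cV[R]_n -> 'cV[R]_n) (x0 : 'cV[R]_n) : R -> 'cV[R]_n :=
  get [set phi | is_trajectory D F x0 phi].

(* The norm on 'cV[R]_n is the maximum norm. *)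
Definition stable (R : realType) (n : nat) (D : set 'cV[R]_n)
    (F : 'cV[R]_n -> 'cV[R]_n) : Prop :=
  forall e : R, 0 < e -> exists2 d : R, 0 < d &
    forall x0, D x0 -> `|x0| < d ->
      trajectory_exists D F x0 /\
      forall t : R, 0 <= t -> `|trajectory D F x0 t| < e.

Definition stabilizes (R : realType) (n : nat) (D : set 'cV[R]_n)
    (F : 'cV[R]_n -> 'cV[R]_n) (Omega : set 'cV[R]_n) : Prop :=
  [/\ forall x0, Omega x0 -> trajectory_exists D F x0,
      stable D F &
      forall x0, Omega x0 ->
        trajectory D F x0 t @[t --> +oo] --> (0 : 'cV[R]_n)].

Definition feasible (R : realType) (n : nat) (D : set 'cV[R]_n)
    (F : 'cV[R]_n -> 'cV[R]_n) (Omega : set 'cV[R]_n) : Prop :=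
  forall x0, Omega x0 -> forall t : R, 0 <= t -> D (trajectory D F x0 t).

Definition policy (R : realType) (n m : nat) (D : set 'cV[R]_n)
    (mu : 'cV[R]_n -> 'cV[R]_m) (Omega : set 'cV[R]_n) : Prop :=
  [/\ region D Omega, {within Omega, continuous mu} & mu 0 = 0].

Definition posdefmx (R : realType) (m : nat) (W : 'M[R]_m) : Prop :=
  W^T = W /\ forall u : 'cV[R]_m, u != 0 -> 0 < (u^T *m W *m u) 0 0.

Definition cost (R : realType) (n m : nat) (Q : 'cV[R]_n -> R) (W : 'M[R]_m)
    (x : 'cV[R]_n) (u : 'cV[R]_m) : R :=
  Q x + (u^T *m W *m u) 0 0.

Definition running_cost (R : realType) (n m : nat) (D : set 'cV[R]_n)
    (f : 'cV[R]_n -> 'cV[R]_n) (g : 'cV[R]_n -> 'M[R]_(n, m))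
    (Q : 'cV[R]_n -> R) (W : 'M[R]_m) (mu : 'cV[R]_n -> 'cV[R]_m)
    (x0 : 'cV[R]_n) (t : R) : R :=
  let x := trajectory D (closed_loop f g mu) x0 t in cost Q W x (mu x).

(* The value is defined, and finite, at x0. *)
Definition value_exists (R : realType) (n m : nat) (D : set 'cV[R]_n)
    (f : 'cV[R]_n -> 'cV[R]_n) (g : 'cV[R]_n -> 'M[R]_(n, m))
    (Q : 'cV[R]_n -> R) (W : 'M[R]_m) (mu : 'cV[R]_n -> 'cV[R]_m)
    (x0 : 'cV[R]_n) : Prop :=
  trajectory_exists D (closed_loop f g mu) x0 /\
  (@lebesgue_measure R).-integrable `[0, +oo[
    (EFin \o running_cost D f g Q W mu x0).

(* Meaningful only where value_exists holds. *)
Definition value (R : realType) (n m : nat) (D : set 'cV[R]_n)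
    (f : 'cV[R]_n -> 'cV[R]_n) (g : 'cV[R]_n -> 'M[R]_(n, m))
    (Q : 'cV[R]_n -> R) (W : 'M[R]_m) (mu : 'cV[R]_n -> 'cV[R]_m)
    (x0 : 'cV[R]_n) : R :=
  (\int[@lebesgue_measure R]_(t in `[0%R, +oo[)
     running_cost D f g Q W mu x0 t)%R.

Definition value_sublevel (R : realType) (n m : nat) (D : set 'cV[R]_n)
    (f : 'cV[R]_n -> 'cV[R]_n) (g : 'cV[R]_n -> 'M[R]_(n, m))
    (Q : 'cV[R]_n -> R) (W : 'M[R]_m) (mu : 'cV[R]_n -> 'cV[R]_m)
    (c : R) : set 'cV[R]_n :=
  [set x | value_exists D f g Q W mu x /\ value D f g Q W mu x <= c].

Definition gradient (R : realType) (n : nat) (h : 'cV[R]_n -> R)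
    (x : 'cV[R]_n) : 'cV[R]_n :=
  \col_i 'D_(delta_mx i 0) h x.

(* The gradient exists in the Frechet sense at every point of Omega, boundary
   points included; this presupposes that the value is defined around each
   point of Omega, not only on Omega. *)
Definition value_C1 (R : realType) (n m : nat) (D : set 'cV[R]_n)
    (f : 'cV[R]_n -> 'cV[R]_n) (g : 'cV[R]_n -> 'M[R]_(n, m))
    (Q : 'cV[R]_n -> R) (W : 'M[R]_m) (mu : 'cV[R]_n -> 'cV[R]_m)
    (Omega : set 'cV[R]_n) : Prop :=
  (forall x, Omega x ->
     (\forall y \near x, value_exists D f g Q W mu y) /\
     differentiable (value D f g Q W mu) x) /\
  {within Omega, continuous (gradient (value D f g Q W mu))}.

Definition admissible (R : realType) (n m : nat) (D : set 'cV[R]_n)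
    (f : 'cV[R]_n -> 'cV[R]_n) (g : 'cV[R]_n -> 'M[R]_(n, m))
    (Q : 'cV[R]_n -> R) (W : 'M[R]_m) (mu : 'cV[R]_n -> 'cV[R]_m)
    (Omega : set 'cV[R]_n) : Prop :=
  [/\ policy D mu Omega,
      stabilizes D (closed_loop f g mu) Omega,
      feasible D (closed_loop f g mu) Omega &
      forall x0, Omega x0 -> value_exists D f g Q W mu x0].

Definition invariantly_admissible (R : realType) (n m : nat)
    (D : set 'cV[R]_n) (f : 'cV[R]_n -> 'cV[R]_n)
    (g : 'cV[R]_n -> 'M[R]_(n, m)) (Q : 'cV[R]_n -> R) (W : 'M[R]_m)
    (mu : 'cV[R]_n -> 'cV[R]_m) (Omega : set 'cV[R]_n) : Prop :=
  admissible D f g Q W mu Omega /\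
  forall x0, Omega x0 ->
    forall t : R, 0 <= t -> Omega (trajectory D (closed_loop f g mu) x0 t).

(* Main.v *)
(* On K = {V <= c}, V the value function of the current policy u, the dynamic
   programming identity V(x) = int_0^t r + V(phi t) gives dV(f + g u) <= -r(., u),
   and completing the square in the improved policy w = -1/2 W^-1 g^T grad V gives
   dV(f + g w) <= -r(., w). So V is a Lyapunov function on K for the closed loop
   of w: K is compact and invariant, which provides global trajectories,
   stability, convergence to 0 and, by integrating the inequality along a
   trajectory, int_0^oo r(., w) <= V. *)
Require Import Defs.
From HB Require Import structures.
From mathcomp Require Import all_boot all_order all_algebra.
From mathcomp Require Import all_classical all_reals all_analysis.
From mathcomp Require Import measurable_realfun ring lra.

Set Implicit Arguments.
Unset Strict Implicit.
Unset Printing Implicit Defensive.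

Import Order.TTheory GRing.Theory Num.Theory.
Import numFieldNormedType.Exports.

Local Open Scope classical_set_scope.
Local Open Scope ring_scope.

(** The formula for [w] holds on [Omega] only, so off [K] nothing is used about its closed loop
    beyond local Lipschitz continuity on [D]. Global existence thus cannot precede confinement: a
    Lipschitz extension of the field from [K] is solved on the whole half-line, and its solution is
    shown never to leave [K], where both fields agree. Points of [K] may satisfy [V x = c], so
    confinement needs strict decrease of [V]; this holds away from 0 because [Q] is positive there,
    and at 0, where strictness fails, [K] is a neighbourhood. This argument works with right
    derivatives, all that a trajectory has at its starting time. Since [trajectory] is a chosen
    solution, identities between values at two points of one trajectory go through uniqueness. Two
    requirements on a policy region are not Lyapunov statements: connectedness of [K], for which
    trajectories of the old policy serve as paths towards 0, and [w 0 = 0], which holds because [V]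
    has a minimum at 0. *)

(** * Continuity, norms and derivatives of vector-valued curves *)

Lemma continuous_comp_fun (T U V : topologicalType) (h : T -> U) (k : U -> V) :
  continuous h -> continuous k -> continuous (fun t => k (h t)).
Proof. by move=> ch ck t; exact: continuous_comp (ch t) (ck (h t)). Qed.

Lemma within_continuous_comp (T U V : topologicalType) (A : set T)
    (h : T -> U) (k : U -> V) :
  {within A, continuous h} -> continuous k ->
  {within A, continuous (fun t => k (h t))}.
Proof. by move=> ch ck t; exact: (cvg_comp _ _ (ch t) (ck (h t))). Qed.

Lemma cV_norm_le (R : realType) (n : nat) (x : 'cV[R]_n) (M : R) :
  0 <= M -> (forall i, `|x i 0| <= M) -> `|x| <= M.
Proof.
move=> M0 xM; rewrite [leLHS]/Num.Def.normr/= mx_normrE (bigmax_le _ M0)//=.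
by move=> [i j] _ /=; rewrite (ord1 j).
Qed.

Lemma coord_norm_le (R : realType) (n : nat) (x : 'cV[R]_n) i :
  `|x i 0| <= `|x|.
Proof.
by rewrite [leRHS]/Num.Def.normr/= mx_normrE; exact: (le_bigmax _ _ (i, 0)).
Qed.

Lemma cvg_mxP (R : realType) (p q : nat) (T : Type) (F : set_system T)
    (f : T -> 'M[R]_(p, q)) (l : 'M[R]_(p, q)) : Filter F ->
  f @ F --> l <-> forall i j, f t i j @[t --> F] --> l i j.
Proof.
move=> FF; split=> [fl i j|fl].
  exact: (cvg_comp f (fun M : 'M[R]_(p, q) => M i j) fl
    (@coord_continuous R p q i j l)).
apply/cvgrPdist_le => e e0; near=> t.
rewrite [leLHS]/Num.Def.normr/= mx_normrE (bigmax_le _ (ltW e0))//= => i _.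
rewrite !mxE; move: i; near: t; apply: filter_forall => /= i.
by move: (fl i.1 i.2) => /cvgrPdist_le; apply.
Unshelve. all: by end_near. Qed.

(** Monotonicity of [u - v]. Derivatives are compared pointwise and never integrated, so an upper
    bound on the derivative of [u] is enough. *)
Lemma ler_derive_increment (R : realType) (u v : R -> R) (a b : R) :
  a <= b -> {within `[a, b], continuous u} -> {within `[a, b], continuous v} ->
  (forall t, a < t < b -> exists du dv : R,
     [/\ is_derive t 1 u du, is_derive t 1 v dv & du <= dv]) ->
  u b - u a <= v b - v a.
Proof.
move=> ab cu cv duv.
have d t : a < t < b -> exists2 dw, is_derive t 1 (u \- v) dw & dw <= 0.
  move=> /duv [du [dv [du' dv' le]]]; exists (du - dv); last by rewrite subr_le0.
  exact: is_deriveB.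
have : (u \- v) b <= (u \- v) a.
  apply: (@ler0_derive1_le_cc R (u \- v) a b) => //.
  - by move=> x; rewrite in_itv/= => /d [dw [? _] _].
  - move=> x; rewrite in_itv/= => /d [dw [dd E] dw0].
    by rewrite derive1E E.
  - by move=> x; apply: continuousB; [exact: cu|exact: cv].
  - by rewrite in_itv/= lexx ab.
  - by rewrite in_itv/= lexx ab.
by rewrite /=; lra.
Qed.

Lemma is_derive_mxP (R : realType) (p q : nat) (h : R -> 'M[R]_(p, q))
    (t : R) (dh : 'M[R]_(p, q)) :
  is_derive t 1 h dh <->
  forall i j, is_derive t 1 (fun s => h s i j) (dh i j).
Proof.
split=> [[dvh <-] i j|dvh].
  split; first by move/derivable_mxP : dvh; apply.
  by rewrite derive_mx// mxE.
have dv : derivable h t 1.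
  by apply/derivable_mxP => i j; have [] := dvh i j.
split=> //; rewrite derive_mx//; apply/matrixP => i j; rewrite mxE.
by have [] := dvh i j.
Qed.

Lemma is_derive_expR_scale (R : realType) (A a t : R) :
  is_derive t 1 (fun s => A * expR (a * s)) (A * a * expR (a * t)).
Proof.
have d : is_derive t 1 (fun s : R => a * s) a.
  have := @is_deriveZ _ _ _ (id : R -> R) a t 1 1 (is_derive_id _ _).
  by rewrite /GRing.scale/= mulr1.
have := @is_derive1_comp _ expR (fun s : R => a * s) t (expR (a * t)) a _ d.
move=> /(_ _) d2.
have := @is_deriveZ _ _ _ _ A t 1 _ d2.
by rewrite /GRing.scale/= mulrA mulrAC.
Qed.

Lemma continuous_expR_scale (R : realType) (A a : R) :
  continuous (fun s => A * expR (a * s)).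
Proof.
move=> t; apply/differentiable_continuous/derivable1_diffP.
by have [] := is_derive_expR_scale A a t.
Qed.

(** The bound is the integral of [A * a * expR (a * t)]. As the norm is the maximum norm, it
    suffices to compare each coordinate, with either sign, to [A * expR (a * t)]. Both the Picard
    contraction and uniqueness rest on this estimate. *)
Lemma norm_le_expR (R : realType) (n : nat) (h dh : R -> 'cV[R]_n)
    (A a T : R) :
  0 < a -> 0 <= T -> 0 <= A -> {within `[0, T], continuous h} -> h 0 = 0 ->
  (forall t : R, 0 < t < T -> is_derive t 1 h (dh t)) ->
  (forall t : R, 0 < t < T -> `|dh t| <= A * a * expR (a * t)) ->
  `|h T| <= A * (expR (a * T) - 1).
Proof.
move=> a0 T0 A0 ch h0 dhE dhle.
have E1 : 1 <= expR (a * T) by rewrite -expR0 ler_expR mulr_ge0 // ltW.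
apply: cV_norm_le => [|i]; first by rewrite mulr_ge0// subr_ge0.
have chi : {within `[0, T], continuous (fun t => h t i 0)}.
  exact: within_continuous_comp ch (@coord_continuous R _ _ i 0).
have cE : {within `[0, T], continuous (fun s => A * expR (a * s))}.
  exact/continuous_subspaceT/continuous_expR_scale.
have di t : 0 < t < T -> is_derive t 1 (fun s => h s i 0) (dh t i 0).
  by move=> /dhE /is_derive_mxP.
have bi t : 0 < t < T -> `|dh t i 0| <= A * a * expR (a * t).
  by move=> /dhle; apply: le_trans; exact: coord_norm_le.
rewrite ler_norml; apply/andP; split.
- have := @ler_derive_increment R (fun t => - h t i 0) _ 0 T T0 _ cE.
  rewrite mulr0 expR0 h0 mxE => H.
  suff : - h T i 0 - - 0 <= A * expR (a * T) - A * 1 by lra.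
  apply: H; first by move=> t; apply: continuousN; exact: chi.
  move=> t tT; exists (- dh t i 0), (A * a * expR (a * t)); split.
  + by apply: is_deriveN; exact: di.
  + exact: is_derive_expR_scale.
  + by have := bi _ tT; rewrite ler_norml => /andP[]; lra.
- have := @ler_derive_increment R (fun t => h t i 0) _ 0 T T0 chi cE.
  rewrite mulr0 expR0 h0 mxE => H.
  suff : h T i 0 - 0 <= A * expR (a * T) - A * 1 by lra.
  apply: H => t tT; exists (dh t i 0), (A * a * expR (a * t)); split.
  + exact: di.
  + exact: is_derive_expR_scale.
  + by have := bi _ tT; rewrite ler_norml => /andP[].
Qed.

(* The library's local Lipschitz property quantifies over neighbourhoods of
   pairs in [D `*` D], so compactness of [K `*` K] yields a uniform constant. *)
Lemma lipschitz_compact (R : realType) (n p : nat) (D K : set 'cV[R]_n)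
    (F : 'cV[R]_n -> 'cV[R]_p) :
  compact K -> K `<=` D -> [locally [lipschitz F x | x in D]] ->
  exists2 L : R, 0 < L &
    forall x y, K x -> K y -> `|F x - F y| <= L * `|x - y|.
Proof.
move=> cK KD Flip.
have cKK : compact (K `*` K) by exact: compact_setX.
have /compact_near_coveringP/near_covering_withinP := cKK.
move=> /(_ R +oo (fun L z => `|F z.1 - F z.2| <= L * `|z.1 - z.2|) _) H.
have : \forall L \near +oo, K `*` K `<=`
    (fun z => `|F z.1 - F z.2| <= L * `|z.1 - z.2|).
  apply: H => z [/= Kz1 Kz2].
  have := Flip z (conj (KD _ Kz1) (KD _ Kz2)).
  move=> /pinfty_ex_gt0 [M M0]; rewrite /dominated_by /within/= => HM.
  exists ((fun z => (D `*` D) z -> `|F z.1 - F z.2| <= M * `|z.1 - z.2|),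
      [set L | M <= L]) => /=.
    by split; [exact: HM|exact: nbhs_pinfty_ge (num_real M)].
  move=> [z' L] [/= Hz' ML] [K1 K2].
  apply: le_trans (Hz' _) _; first by split; exact: KD.
  by rewrite ler_wpM2r.
move=> /pinfty_ex_gt0 [L L0 HL]; exists L => // x y Kx Ky.
exact: (HL (x, y)).
Qed.

(** * Curves on the closed half-line and their antiderivatives *)

(** Precomposing with [Num.max 0 t] encodes continuity on [[0, +oo[]: curves are unconstrained at
    negative times, and the clamped curve is continuous on all of [R]. *)
Lemma continuous_clamp (R : realType) (V : normedModType R) (phi : R -> V) :
  phi h @[h --> 0^'+] --> phi 0 ->
  (forall t : R, 0 < t -> {for t, continuous phi}) ->
  continuous (fun t : R => phi (Num.max 0 t)).
Proof.
move=> phi0 cphi t; have [t0|t0|->] := ltrgtP t 0.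
- rewrite /continuous_at max_l ?(ltW t0)//; apply/cvgrPdist_le => e e0.
  near=> s; rewrite max_l ?subrr ?normr0 ?ltW//; near: s; exact: lt_nbhsl.
- rewrite /continuous_at max_r ?(ltW t0)//; apply/cvgrPdist_le => e e0.
  near=> s; rewrite max_r.
    by near: s; move: (cphi _ t0) => /cvgrPdist_le; exact.
  by apply/ltW; near: s; exact: lt_nbhsr.
- rewrite /continuous_at maxxx; apply/cvgrPdist_le => e e0.
  move/cvgrPdist_le : phi0 => /(_ e e0) [d /= d0 dP].
  near=> s; have [s0|s0] := leP s 0; first by rewrite subrr normr0 ltW.
  by apply: dP => //=.
Unshelve. all: by end_near. Qed.

Lemma derivable_continuous_at (R : realType) (V : normedModType R) (phi : R -> V)
    t : derivable phi t 1 -> {for t, continuous phi}.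
Proof. by move=> /derivable1_diffP; exact: differentiable_continuous. Qed.

Lemma continuous_clamp_derivable (R : realType) (V : normedModType R)
    (phi : R -> V) :
  (forall t : R, 0 <= t -> derivable phi t 1) ->
  continuous (fun t : R => phi (Num.max 0 t)).
Proof.
move=> dphi; apply: continuous_clamp => [|t t0].
  apply: cvg_at_right_filter; exact/derivable_continuous_at/dphi.
exact/derivable_continuous_at/dphi/ltW.
Qed.

Lemma within_continuous_clamp (R : realType) (V : topologicalType)
    (phi : R -> V) (a b : R) : 0 <= a ->
  continuous (fun t : R => phi (Num.max 0 t)) -> {within `[a, b], continuous phi}.
Proof.
move=> a0 cphi; apply: (@subspace_eq_continuous _ _ _ (fun t : R => phi (Num.max 0 t))).
  by move=> t; rewrite inE/= in_itv/= => /andP[at_ _]; rewrite max_r// (le_trans a0).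
exact: continuous_subspaceT.
Qed.

Section primitive.
Context {R : realType}.
Notation mu := (@lebesgue_measure R).

Lemma continuous_itv_integrable (u : R -> R) (a b : R) :
  continuous u -> mu.-integrable `[a, b] (EFin \o u).
Proof.
move=> cu; apply: continuous_compact_integrable.
  exact: segment_compact.
exact: continuous_subspaceT.
Qed.

(** The lower limit -1 makes 0 an interior point, so that the derivative at [t = 0] is two-sided;
    subtracting the integral up to 0 normalizes the primitive to vanish there. *)
Lemma is_derive_primitive (u : R -> R) (t : R) : continuous u -> 0 <= t ->
  is_derive t 1
    (fun s => \int[mu]_(x in `[-1, s]) u x - \int[mu]_(x in `[-1, 0]) u x)
    (u t).
Proof.
move=> cu t0.
have [] := @continuous_FTC1_closed R u (-1) t (t + 1) _
  (continuous_itv_integrable _ _ cu) _ (cu t); [lra|lra|].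
move=> dF F'.
have dd : is_derive t 1 (fun s => \int[mu]_(x in `[-1, s]) u x) (u t).
  by split => //; rewrite -derive1E.
have := @is_deriveB _ _ _ _ (cst (\int[mu]_(x in `[-1, 0]) u x)) t 1 _ 0 dd _.
by rewrite subr0; apply.
Qed.

Lemma primitiveE (u : R -> R) (t : R) : continuous u -> 0 <= t ->
  \int[mu]_(x in `[-1, t]) u x - \int[mu]_(x in `[-1, 0]) u x =
  \int[mu]_(x in `[0, t]) u x.
Proof.
move=> cu t0; rewrite Rintegral_itvB ?bnd_simp//; last exact: continuous_itv_integrable.
rewrite Rintegral_itv_obnd_cbnd//.
apply: integrableS (continuous_itv_integrable 0 t cu) => //.
by move=> x /=; rewrite !in_itv/= => /andP[/ltW -> ->].
Qed.

Lemma antiderivative (n : nat) (u : R -> 'cV[R]_n) : continuous u ->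
  exists U : R -> 'cV[R]_n, U 0 = 0 /\
    forall t : R, 0 <= t -> is_derive t 1 U (u t).
Proof.
move=> cu; exists (fun s => \col_i (\int[mu]_(x in `[-1, s]) u x i 0 -
   \int[mu]_(x in `[-1, 0]) u x i 0)); split.
  by apply/colP => i; rewrite !mxE subrr.
move=> t t0; apply/is_derive_mxP => i j; rewrite (ord1 j).
have cui : continuous (fun x => u x i 0).
  move=> x; exact: (cvg_comp u (fun M : 'cV[R]_n => M i 0) (cu x)
    (@coord_continuous R n 1 i 0 (u x))).
by under eq_fun do rewrite mxE; exact: is_derive_primitive.
Qed.

End primitive.

(** * Global solutions of Lipschitz fields and extension of Lipschitz maps *)

Lemma geometric_small (R : realType) (B e : R) : 0 < e ->
  exists k : nat, B * 2^-1 ^+ k <= e.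
Proof.
move=> e0.
have : B * 2^-1 ^+ k @[k --> \oo] --> B * 0.
  apply: cvgMr; apply: cvg_expr.
  by rewrite ger0_norm; lra.
rewrite mulr0 => /cvgrPdist_le /(_ e e0) [k _ kP].
exists k; have := kP k (leqnn k); rewrite /= sub0r normrN.
exact: le_trans (ler_norm _).
Qed.

Lemma lipschitz_continuous (R : realType) (V W : normedModType R) (G : V -> W)
    (L : R) : 0 < L -> (forall x y, `|G x - G y| <= L * `|x - y|) ->
  continuous G.
Proof.
move=> L0 GL x; apply/cvgrPdist_le => e e0; apply/nbhs_normP.
exists (L^-1 * e) => /=; first by rewrite mulr_gt0// invr_gt0.
by move=> y /= xy; rewrite (le_trans (GL _ _))// -ler_pdivlMl// ltW.
Qed.

Section picard.
Context {R : realType} {n : nat}.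
Variables (G : 'cV[R]_n -> 'cV[R]_n) (L : R) (x0 : 'cV[R]_n).
Hypothesis L0 : 0 < L.
Hypothesis GL : forall x y, `|G x - G y| <= L * `|x - y|.

Let continuous_G : continuous G. Proof. exact: lipschitz_continuous L0 GL. Qed.

(** [psi] is the Picard image [x0 + int_0^t G (phi s) ds] of [phi], specified by its derivative. It
    is a relation because [psi] is left free at negative times. *)
Let solves (phi psi : R -> 'cV[R]_n) :=
  psi 0 = x0 /\ forall t : R, 0 <= t -> is_derive t 1 psi (G (phi (Num.max 0 t))).

Let step (phi : R -> 'cV[R]_n) := get (solves phi).

Let clampc (phi : R -> 'cV[R]_n) := continuous (fun t : R => phi (Num.max 0 t)).

Let stepP phi : clampc phi -> solves phi (step phi).
Proof.
move=> cphi; apply: getPex.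
have [|U [U0 dU]] := @antiderivative R n (fun t => G (phi (Num.max 0 t))).
  exact: (continuous_comp_fun cphi continuous_G).
exists (fun t => x0 + U t); split; first by rewrite U0 addr0.
move=> t t0; have := is_deriveD (is_derive_cst x0 t 1) (dU t t0).
by rewrite add0r.
Qed.

Let solves_clampc phi psi : solves phi psi -> clampc psi.
Proof.
by move=> [_ dpsi]; apply: continuous_clamp_derivable => t /dpsi [].
Qed.

(* The weight [expR (2 * L * t)] makes the Picard operator a contraction of
   ratio 1/2 on the whole half-line. *)
Let solves_contract phi1 phi2 psi1 psi2 A :
  solves phi1 psi1 -> solves phi2 psi2 -> 0 <= A ->
  (forall t : R, 0 <= t -> `|phi1 t - phi2 t| <= A * expR (2 * L * t)) ->
  forall t : R, 0 <= t -> `|psi1 t - psi2 t| <= A / 2 * expR (2 * L * t).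
Proof.
move=> [i1 d1] [i2 d2] A0 H t t0.
have a0 : 0 < 2 * L by rewrite mulr_gt0.
apply: (@le_trans _ _ (A / 2 * (expR (2 * L * t) - 1))); last first.
  by rewrite ler_wpM2l ?divr_ge0// gerBl.
apply: (@norm_le_expR R n (fun t => psi1 t - psi2 t)
    (fun t => G (phi1 (Num.max 0 t)) - G (phi2 (Num.max 0 t)))) => //.
- by rewrite divr_ge0.
- apply: within_continuous_clamp => //.
  apply: (continuous_clamp_derivable (phi := fun t => psi1 t - psi2 t)) => s s0.
  by apply: derivableB;
    [have [] := d1 s s0|have [] := d2 s s0].
- by rewrite i1 i2 subrr.
- by move=> s /andP[/ltW s0 _]; exact: is_deriveB (d1 s s0) (d2 s s0).
- move=> s /andP[/ltW s0 _]; rewrite (max_r s0).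
  rewrite (le_trans (GL _ _))//.
  apply: (@le_trans _ _ (L * (A * expR (2 * L * s)))).
    by apply: ler_wpM2l; [exact: ltW|exact: H].
  by rewrite le_eqVlt; apply/orP; left; apply/eqP; field.
Qed.

Let it k := iter k step (cst x0).

Let it_clampc k : clampc (it k).
Proof.
elim: k => [|k ih]; first by move=> t; exact: cvg_cst.
exact: solves_clampc (stepP ih).
Qed.

Let it_solves k : solves (it k) (it k.+1).
Proof. exact: stepP. Qed.

(** Chosen so that [C * (2 * L)] is [|G x0|], the speed at which the first iterate leaves the
    constant curve; this starts the geometric estimate on successive iterates. *)
Let C := `|G x0| / (2 * L).

Let C0 : 0 <= C. Proof. by rewrite divr_ge0// mulr_ge0// ltW. Qed.

Let Ck0 k : 0 <= 2 * C * 2^-1 ^+ k.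
Proof.
by apply: mulr_ge0; [apply: mulr_ge0|apply: exprn_ge0; rewrite invr_ge0].
Qed.

Let it_dist k t : 0 <= t ->
  `|it k.+1 t - it k t| <= C * 2^-1 ^+ k * expR (2 * L * t).
Proof.
elim: k t => [|k ih] t t0; last first.
  have := solves_contract (it_solves k.+1) (it_solves k) _ ih t0.
  rewrite exprS mulrA (mulrC _ 2^-1) mulrA (mulrC 2^-1) => -> //.
  by rewrite mulr_ge0// exprn_ge0.
rewrite expr0 mulr1.
have a0 : 0 < 2 * L by rewrite mulr_gt0.
have [i1 d1] := it_solves 0.
apply: (@le_trans _ _ (C * (expR (2 * L * t) - 1))); last first.
  by rewrite ler_wpM2l // gerBl.
apply: (@norm_le_expR R n (fun t => it 1 t - it 0 t) (fun=> G x0)) => //.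
- apply: within_continuous_clamp => //.
  apply: (continuous_clamp_derivable (phi := fun t => it 1 t - it 0 t)) => s s0.
  apply: derivableB.
    by have [] := d1 s s0.
  exact: derivable_cst.
- by rewrite i1 /it/= subrr.
- move=> s /andP[/ltW s0 _].
  by have := is_deriveB (d1 s s0) (is_derive_cst x0 s 1); rewrite subr0.
- move=> s /andP[s0 _]; rewrite /C divfK ?gt_eqF//.
  by rewrite ler_peMr// -[leLHS]expR0 ler_expR mulr_ge0 ?(ltW a0) ?(ltW s0).
Qed.

Let it_tail k j t : 0 <= t ->
  `|it (k + j) t - it k t| <= 2 * C * 2^-1 ^+ k * expR (2 * L * t).
Proof.
move=> t0.
have E0 : 0 <= expR (2 * L * t) by exact: expR_ge0.
(* The bound is sharpened to a telescoping difference of powers of 1/2, for which the induction on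
   [j] closes. *)
apply: (@le_trans _ _
   (2 * C * (2^-1 ^+ k - 2^-1 ^+ (k + j)) * expR (2 * L * t))); last first.
  apply: ler_wpM2r => //; apply: ler_wpM2l; first by rewrite mulr_ge0.
  by rewrite gerBl exprn_ge0.
elim: j => [|j ih]; first by rewrite addn0 !subrr normr0 mulr0 mul0r.
rewrite addnS -(subrKA (it (k + j) t)) (le_trans (ler_normD _ _))//.
rewrite (le_trans (lerD (it_dist _ t0) ih))//.
rewrite exprS; lra.
Qed.

Let it_lim t : 0 <= t -> cvg (it k t @[k --> \oo]).
Proof.
move=> t0; apply: cauchy_cvg; apply: cauchy_exP => e e0.
have e20 : 0 < e / 2 by rewrite divr_gt0.
have [k kP] := geometric_small (2 * C * expR (2 * L * t)) e20.
exists (it k t); exists k => // j /= kj.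
rewrite -ball_normE/= distrC -(subnKC kj).
apply: (@le_lt_trans _ _ (e / 2)); last by rewrite ltr_pdivrMr// ltr_pMr// ltr1n.
by apply: le_trans kP; rewrite mulrAC; exact: it_tail.
Qed.

Let sol t := lim (it k t @[k --> \oo]).

Let sol_dist k t : 0 <= t ->
  `|sol t - it k t| <= 2 * C * 2^-1 ^+ k * expR (2 * L * t).
Proof.
move=> t0; apply/ler_addgt0Pr => e e0.
have /cvgrPdist_le /(_ e e0) [j _ jP] := it_lim t0.
have := jP (k + j)%N (leq_addl _ _) => /= jP'.
rewrite -(subrKA (it (k + j) t)) (le_trans (ler_normD _ _))// addrC lerD//.
exact: it_tail.
Qed.

Let sol_clampc : clampc sol.
Proof.
move=> t; apply/cvgrPdist_le => e e0.
have e30 : 0 < e / 3 by rewrite divr_gt0.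
(* [k] is fixed for the whole horizon [Num.max 0 t + 1], so a single iterate approximates [sol]
   within [e / 3] at all times near [t]. *)
have [k kP] := geometric_small (2 * C * expR (2 * L * (Num.max 0 t + 1))) e30.
have bnd s : 0 <= s -> s <= Num.max 0 t + 1 -> `|sol s - it k s| <= e / 3.
  move=> s0 st; apply: le_trans kP; rewrite mulrAC.
  apply: le_trans (sol_dist k s0) _; apply: ler_wpM2l => //.
  by rewrite ler_expR ler_wpM2l// mulr_ge0// ltW.
near=> s.
have N : `|it k (Num.max 0 t) - it k (Num.max 0 s)| <= e / 3.
  by near: s; move: (@it_clampc k t) => /cvgrPdist_le; apply.
have s1 : Num.max 0 s <= Num.max 0 t + 1.
  have st : s <= t + 1 by apply/ltW; near: s; apply: lt_nbhsl; rewrite ltrDl.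
  rewrite ge_max; apply/andP; split.
    by rewrite addr_ge0// le_max lexx.
  by rewrite (le_trans st)// lerD2r le_max lexx orbT.
set a := Num.max 0 t; set b := Num.max 0 s.
have -> : sol a - sol b =
    (sol a - it k a) + (it k a - it k b) - (sol b - it k b).
  by rewrite opprB !addrA subrK subrK.
rewrite (le_trans (ler_normB _ _))// (le_trans (lerD (ler_normD _ _) (lexx _)))//.
have -> : e = e / 3 + e / 3 + e / 3 by field.
rewrite !lerD//.
- by rewrite bnd /a ?le_max ?lexx// lerDl.
- by rewrite bnd /b ?le_max ?lexx.
Unshelve. all: by end_near. Qed.

Lemma picard_lindelof : exists phi : R -> 'cV[R]_n,
  phi 0 = x0 /\ forall t : R, 0 <= t -> is_derive t 1 phi (G (phi t)).
Proof.
have S := stepP sol_clampc.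
(* Both [step sol] and [sol] lie within [C * 2^-1 ^+ k * expR (2 * L * t)] of iterate [k.+1], and
   [k] is arbitrary. *)
have E t : 0 <= t -> step sol t = sol t.
  move=> t0; apply/eqP; rewrite -subr_eq0 -normr_le0; apply/ler_addgt0Pr => e e0.
  have [k kP] := geometric_small (2 * C * expR (2 * L * t)) e0.
  have d1 := solves_contract S (it_solves k) (Ck0 k) (@sol_dist k) t0.
  have d2 := sol_dist k.+1 t0.
  rewrite add0r (le_trans _ kP)//.
  rewrite -(subrKA (it k.+1 t)) (le_trans (ler_normD _ _))// -[X in _ + X]normrN opprB.
  rewrite (le_trans (lerD d1 d2))// exprS.
  lra.
(* The witness is [step sol] rather than [sol]: they agree for [t >= 0], but only the former is
   known to have a two-sided derivative at 0. *)
exists (step sol); split; first exact: S.1.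
by move=> t t0; rewrite (E t t0) -[X in sol X](max_r t0); exact: S.2.
Qed.

End picard.

(* McShane's extension. *)
Lemma lipschitz_extensionR (R : realType) (V : normedModType R) (K : set V)
    (f : V -> R) (L : R) : 0 <= L -> K !=set0 ->
  (forall x y, K x -> K y -> `|f x - f y| <= L * `|x - y|) ->
  exists g : V -> R,
    (forall x y, `|g x - g y| <= L * `|x - y|) /\ forall x, K x -> g x = f x.
Proof.
move=> L0 [z Kz] fL.
pose S x := [set f y + L * `|x - y| | y in K].
have S0 x : S x !=set0 by exists (f z + L * `|x - z|), z.
have Slb x : has_lbound (S x).
  exists (f z - L * `|x - z|) => _ [y Ky <-].
  have := fL z y Kz Ky; rewrite ler_norml => /andP[_].
  have : L * `|z - y| <= L * `|x - z| + L * `|x - y|.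
    by rewrite -mulrDr ler_wpM2l// (distrC x z) -(subrKA x) ler_normD.
  lra.
have gle x y : K y -> inf (S x) <= f y + L * `|x - y|.
  by move=> Ky; apply: ge_inf => //; exists y.
have geg x l : (forall y, K y -> l <= f y + L * `|x - y|) -> l <= inf (S x).
  by move=> H; apply: lb_le_inf => // _ [y Ky <-]; exact: H.
have half x y : inf (S x) - L * `|x - y| <= inf (S y).
  apply: geg => w Kw; have := gle x w Kw.
  have : L * `|x - w| <= L * `|x - y| + L * `|y - w|.
    by rewrite -mulrDr ler_wpM2l// -(subrKA y) ler_normD.
  lra.
exists (fun x => inf (S x)); split=> [x y|x Kx].
  rewrite ler_norml; have := half x y; have := half y x; rewrite (distrC y x).
  lra.
apply/eqP; rewrite eq_le; apply/andP; split.
  by have := gle x x Kx; rewrite subrr normr0 mulr0 addr0.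
apply: geg => y Ky; have := fL x y Kx Ky; rewrite ler_norml => /andP[_].
lra.
Qed.

(** Extending each coordinate separately keeps the constant [L], because the norm is the maximum
    norm. *)
Lemma lipschitz_extension (R : realType) (n p : nat) (K : set 'cV[R]_n)
    (F : 'cV[R]_n -> 'cV[R]_p) (L : R) : 0 <= L -> K !=set0 ->
  (forall x y, K x -> K y -> `|F x - F y| <= L * `|x - y|) ->
  exists G : 'cV[R]_n -> 'cV[R]_p,
    (forall x y, `|G x - G y| <= L * `|x - y|) /\ forall x, K x -> G x = F x.
Proof.
move=> L0 K0 FL.
have Fi i : exists g : 'cV[R]_n -> R,
    (forall x y, `|g x - g y| <= L * `|x - y|) /\
    forall x, K x -> g x = F x i 0.
  apply: lipschitz_extensionR => // x y Kx Ky.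
  apply: le_trans (FL x y Kx Ky).
  by have := coord_norm_le (F x - F y) i; rewrite !mxE.
have [g gP] := choice Fi.
exists (fun x => \col_i g i x); split=> [x y|x Kx].
  apply: cV_norm_le => [|i]; first by rewrite mulr_ge0.
  by rewrite !mxE; exact: (gP i).1.
by apply/colP => i; rewrite mxE; exact: (gP i).2.
Qed.

(** * Trajectories: uniqueness, one-sided chain rule, forward invariance *)

Section trajectories.
Context {R : realType} {n : nat}.
Implicit Types (D K : set 'cV[R]_n) (F : 'cV[R]_n -> 'cV[R]_n).

(** Continuity at time 0 is not part of [is_trajectory]; it follows from the right derivative,
    [phi h] being [h] times a convergent quotient plus [phi 0]. *)
Lemma trajectory_clamp_continuous D F x0 phi : is_trajectory D F x0 phi ->
  continuous (fun t : R => phi (Num.max 0 t)).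
Proof.
move=> [_ _ dphi rphi]; apply: continuous_clamp => [|t t0]; last first.
  by apply: derivable_continuous_at; have [] := dphi t t0.
have : h *: (h^-1 *: (phi h - phi 0)) + phi 0 @[h --> 0^'+] -->
    (0 : R) *: F (phi 0) + phi 0.
  apply: cvgD; last exact: cvg_cst.
  apply: cvgZ rphi; apply: cvg_at_right_filter; exact: cvg_id.
rewrite scale0r add0r; apply: cvg_trans; apply: near_eq_cvg.
near=> h; rewrite scalerA mulfV ?scale1r ?subrK//.
Unshelve. all: by end_near. Qed.

Lemma trajectory_right_derivative D F x0 phi (t : R) :
  is_trajectory D F x0 phi -> 0 <= t ->
  h^-1 *: (phi (t + h) - phi t) @[h --> 0^'+] --> F (phi t).
Proof.
move=> [_ _ dphi rphi]; rewrite le_eqVlt => /predU1P[<-|t0].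
  by under eq_fun do rewrite add0r.
have [dv dvE] := dphi t t0.
have : h^-1 *: (phi (h *: 1 + t) - phi t) @[h --> 0^'+] --> F (phi t).
  by rewrite -dvE; apply: cvg_dnbhs_at_right; exact: dv.
rewrite (_ : (fun h => _) = (fun h => h^-1 *: (phi (t + h) - phi t)))//.
by apply/funext => h; rewrite [h *: 1]mulr1 [h + t]addrC.
Qed.

(** In place of Gronwall's inequality, the weighted distance [E t = expR (- (2 * L * t)) * |h t|] is
    maximized over [[0, T]], say at [c]. The contraction estimate gives
    [E c * X <= E c / 2 * (X - 1)] with [X = expR (2 * L * c) > 0], which forces [E c <= 0]. *)
Lemma trajectory_unique D F x0 phi1 phi2 :
  [locally [lipschitz F x | x in D]] ->
  is_trajectory D F x0 phi1 -> is_trajectory D F x0 phi2 ->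
  forall t : R, 0 <= t -> phi1 t = phi2 t.
Proof.
move=> Flip tr1 tr2 T T0.
have c1 := trajectory_clamp_continuous tr1.
have c2 := trajectory_clamp_continuous tr2.
have w1 := within_continuous_clamp (b := T) (lexx 0) c1.
have w2 := within_continuous_clamp (b := T) (lexx 0) c2.
case: tr1 tr2 => [i1 D1 d1 _] [i2 D2 d2 _].
(* The two arcs form a compact subset of [D], on which [F] has a single Lipschitz constant. *)
pose K := phi1 @` `[0, T] `|` phi2 @` `[0, T].
have cK : compact K.
  by apply: compactU; apply: continuous_compact => //; exact: segment_compact.
have KD : K `<=` D.
  move=> _ [[t /= + <-]|[t /= + <-]]; rewrite in_itv/= => /andP[t0 _].
    exact: D1.
  exact: D2.
have [L L0 FL] := lipschitz_compact cK KD Flip.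
pose h t := phi1 t - phi2 t.
have ch : {within `[0, T], continuous h}.
  apply: within_continuous_clamp => //.
  by move=> t; apply: continuousB; [exact: c1|exact: c2].
have a0 : 0 < 2 * L by rewrite mulr_gt0.
pose E t := expR (- (2 * L * t)) * `|h t|.
have cE : {within `[0, T], continuous E}.
  have c3 : {within `[0, T], continuous (fun t => expR (- (2 * L * t)))}.
    apply: continuous_subspaceT => s.
    have := @continuous_expR_scale R 1 (- (2 * L)) s.
    by under eq_fun do rewrite mul1r mulNr.
  have c4 := within_continuous_comp ch (@norm_continuous _ _).
  by move=> t; exact: (continuousM (c3 t) (c4 t)).
have [c c0T maxE] := EVT_max T0 cE.
have hE t : `|h t| = E t * expR (2 * L * t).
  by rewrite /E mulrAC -expRD addNr expR0 mul1r.
have E0 t : 0 <= E t by rewrite mulr_ge0// expR_ge0.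
move: (c0T); rewrite in_itv/= => /andP[c0 cT].
have : `|h c| <= E c / 2 * (expR (2 * L * c) - 1).
  apply: (@norm_le_expR R n h (fun t => F (phi1 t) - F (phi2 t))) => //.
  - by rewrite divr_ge0.
  - by apply: continuous_subspaceW ch; apply: subset_itvl; rewrite bnd_simp.
  - by rewrite /h i1 i2 subrr.
  - by move=> t /andP[t0 _]; exact: is_deriveB (d1 t t0) (d2 t t0).
  - move=> t /andP[t0 tc].
    have tT : `[0, T]%classic t by rewrite /= in_itv/= !ltW// (lt_le_trans tc).
    apply: le_trans (FL _ _ _ _) _; [by left; exists t|by right; exists t|].
    have -> : E c / 2 * (2 * L) * expR (2 * L * t) =
        L * (E c * expR (2 * L * t)) by field.
    rewrite -/(h t) hE; apply: ler_wpM2l; first exact: ltW.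
    by apply: ler_wpM2r; [exact: expR_ge0|exact: maxE].
have := expR_gt0 (2 * L * c); rewrite hE; set X := expR _ => X0 hc.
have Ec0 : E c <= 0 by have := E0 c; nra.
have ET0 : E T <= 0 by apply: le_trans Ec0; apply: maxE; rewrite in_itv/= T0 lexx.
apply/eqP; rewrite -subr_eq0 -normr_le0 -/(h T) hE.
by rewrite mulr_le0_ge0// expR_ge0.
Qed.

(** Chain rule for a curve known only to the right of one instant; the little-o remainder of [V] is
    evaluated at [h *: q h], where the quotient [q h] stays bounded. *)
Lemma right_derivative_comp (V : 'cV[R]_n -> R) (gam : R -> 'cV[R]_n)
    (x v : 'cV[R]_n) :
  differentiable V x -> h^-1 *: (gam h - x) @[h --> 0^'+] --> v ->
  h^-1 * (V (gam h) - V x) @[h --> 0^'+] --> 'd V x v.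
Proof.
move=> dV gv.
pose q (h : R) : 'cV[R]_n := h^-1 *: (gam h - x).
have dq : 'd V x (q h) @[h --> 0^'+] --> 'd V x v.
  have cd : continuous ('d V x : 'cV[R]_n -> R) by exact: diff_continuous.
  exact: (cvg_comp q _ gv (cd v)).
have q0 : h *: q h @[h --> 0^'+] --> (0 : 'cV[R]_n).
  have <- : (0 : R) *: v = 0 by rewrite scale0r.
  by apply: cvgZ gv; apply: cvg_at_right_filter; exact: cvg_id.
suff r0 : h^-1 * (V (gam h) - V x) - 'd V x (q h) @[h --> 0^'+] --> (0 : R).
  have E : (fun h => h^-1 * (V (gam h) - V x)) =
      (fun h => h^-1 * (V (gam h) - V x) - 'd V x (q h) + 'd V x (q h)).
    by apply/funext => h /=; rewrite subrK.
  by rewrite E -[X in _ --> X]add0r; exact: cvgD.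
apply/cvgr0Pnorm_le => e e0.
(* [|v| + 1] eventually bounds [q h], and it stays positive when [v = 0]. *)
have v1 : 0 < `|v| + 1 by rewrite ltr_wpDl.
have [_] := (@diff_locallyP _ _ _ x V).1 dV.
move=> /eqaddoP /(_ (e / (`|v| + 1))); rewrite divr_gt0// => /(_ isT) Ho.
near=> h.
have h0 : 0 < h by [].
have hq : gam h - x = h *: q h by rewrite /q scalerA mulfV ?scale1r// gt_eqF.
have qv : `|q h| <= `|v| + 1.
  by near: h; apply: cvgr_norm_le gv _ _; rewrite ltrDl.
have : `|V (h *: q h + x) - (V x + 'd V x (h *: q h))| <=
    e / (`|v| + 1) * `|h *: q h|.
  by near: h; exact: (q0 _ Ho).
rewrite -hq subrK hq linearZ/= normrZ gtr0_norm// => le1.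
have -> : h^-1 * (V (gam h) - V x) - 'd V x (q h) =
    h^-1 * (V (gam h) - (V x + h *: 'd V x (q h))).
  by rewrite /GRing.scale/=; field; rewrite gt_eqF.
rewrite normrM gtr0_norm ?invr_gt0// ler_pdivrMl// (le_trans le1)//.
rewrite mulrCA ler_pM2l// mulrAC ler_pdivrMr// ler_pM2l//.
Unshelve. all: by end_near. Qed.

Lemma is_derive_comp (V : 'cV[R]_n -> R) (gam : R -> 'cV[R]_n) (t : R) v :
  differentiable V (gam t) -> is_derive t 1 gam v ->
  is_derive t 1 (fun s => V (gam s)) ('d V (gam t) v).
Proof.
move=> dV [dg gv].
have dgd : differentiable gam t by exact/derivable1_diffP.
have dc : differentiable (V \o gam) t by exact: differentiable_comp.
split; first exact/derivable1_diffP.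
rewrite -gv (deriveE _ dc) diff_comp//= deriveE//.
Qed.

(** Continuous induction: if the curve is outside [K] at [t], the times up to which it stays in [K]
    have a supremum [T]. Closedness puts [gam T] in [K], and the local step then carries the curve
    past [T]. *)
Lemma closed_forward_invariant (K : set 'cV[R]_n) (gam : R -> 'cV[R]_n) :
  closed K -> continuous (fun t : R => gam (Num.max 0 t)) -> K (gam 0) ->
  (forall t : R, 0 <= t -> K (gam t) -> \forall h \near 0^'+, K (gam (t + h))) ->
  forall t : R, 0 <= t -> K (gam t).
Proof.
move=> cK cg K0 Kstep t t0; apply: contrapT => nKt.
pose S := [set s | 0 <= s /\ forall r, 0 <= r <= s -> K (gam r)].
have S0 : S 0 by split=> // r; rewrite -eq_le => /eqP <-.
have St s : S s -> s <= t.
  by move=> [s0 Ks]; rewrite leNgt; apply/negP => ts; apply/nKt/Ks; rewrite t0 ltW.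
have supS : has_sup S by split; [exists 0|exists t => s /St].
pose T := sup S.
have T0 : 0 <= T by exact: sup_upper_bound.
have KT r : 0 <= r -> r < T -> K (gam r).
  move=> r0 rT; have e0 : 0 < T - r by rewrite subr_gt0.
  have [s [_ Ks]] := sup_adherent e0 supS; rewrite subKr => rs.
  by apply: Ks; rewrite r0 ltW.
have KgT : K (gam T).
  apply: contrapT => nKT.
  have : nbhs (gam (Num.max 0 T)) (~` K).
    by apply: open_nbhs_nbhs; split; [exact: closed_openC|rewrite max_r].
  move=> /(cg T) /nbhs_normP [d /= d0 dP].
  have := dP (T - d / 2); rewrite /ball_/= opprB addrCA subrr addr0.
  rewrite ger0_norm ?divr_ge0 ?ltW// ltr_pdivrMr// ltr_pMr// ltr1n => /(_ isT).
  apply; have [r0|r0] := leP 0 (T - d / 2); last by [].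
  by apply: KT => //; rewrite gtrBl divr_gt0.
have [d /= d0 dP] := Kstep T T0 KgT.
have : S (T + d / 2).
  split=> [|r /andP[r0 rT]]; first by rewrite addr_ge0// divr_ge0// ltW.
  have [rT'|rT'|->//] := ltrgtP r T; first exact: KT.
  rewrite -(subrKC T r); apply: dP => /=; last by rewrite subr_gt0.
  rewrite sub0r normrN gtr0_norm ?subr_gt0//; lra.
move=> /(sup_upper_bound supS); rewrite -/T; lra.
Qed.

End trajectories.

(** * Integrals over the half-line *)

Section half_line_integrals.
Context {R : realType}.
Notation mu := (@lebesgue_measure R).

Lemma measurable_shift (t : R) :
  measurable_fun [set: measurableTypeR R]
    ((fun x => x + t) : measurableTypeR R -> measurableTypeR R).
Proof.
apply: continuous_measurable_fun => x.
by apply: cvgD; [exact: cvg_id|exact: cvg_cst].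
Qed.

(** Translation invariance, from the uniqueness of Lebesgue measure given its values on intervals
    []a, b]]. *)
Lemma pushforward_shift (t : R) (A : set (measurableTypeR R)) : measurable A ->
  mu A = pushforward mu ((fun x => x + t) :
    measurableTypeR R -> measurableTypeR R) A.
Proof.
move=> mA; apply: lebesgue_measure_unique => //=; first exact: measurable_shift.
move=> _ _ [[a b] _ <-].
rewrite /pushforward/=.
have -> : (fun x => x + t) @^-1` `]a, b] = `]a - t, b - t]%classic.
  by apply/seteqP; split=> x /=; rewrite !in_itv/= ltrBlDr lerBrDr.
rewrite !lebesgue_measure_itv/= !lte_fin ltrD2r.
by case: ifP => // _; rewrite -!EFinD; congr (_%:E); lra.
Qed.

Lemma ge0_integral_shift (r : R -> R) (t : R) :
  measurable_fun `[t, +oo[ r -> (forall x, t <= x -> 0 <= r x) ->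
  (\int[mu]_(x in `[t, +oo[) (r x)%:E =
   \int[mu]_(x in `[0%R, +oo[) (r (x + t))%:E)%E.
Proof.
move=> mr r0.
rewrite (_ : `[0%R, +oo[%classic = ((fun x => x + t) :
    measurableTypeR R -> measurableTypeR R) @^-1` `[t, +oo[); last first.
  by apply/seteqP; split=> x /=; rewrite !in_itv/= !andbT lerDr.
rewrite -(@ge0_integral_pushforward _ _ _ _ _ _ (measurable_shift t) mu _
  (EFin \o r))//; last 2 first.
- exact/measurable_EFinP.
- by move=> x; rewrite inE/= in_itv/= andbT lee_fin => /r0.
apply: eq_measure_integral => //=; first exact: measurable_shift.
by move=> _ A mA _; exact: pushforward_shift.
Qed.

(** The integral form of dynamic programming: cut at [t], then restart the clock. Nonnegativity
    allows shifting the extended integral first and reading integrability off it. *)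
Lemma ge0_Rintegral_split_shift (r : R -> R) (t : R) : 0 <= t ->
  mu.-integrable `[0, +oo[ (EFin \o r) -> (forall x, 0 <= x -> 0 <= r x) ->
  mu.-integrable `[0, +oo[ (EFin \o (fun x => r (x + t))) /\
  \int[mu]_(x in `[0, +oo[) r x =
    \int[mu]_(x in `[0, t]) r x + \int[mu]_(x in `[0, +oo[) r (x + t).
Proof.
move=> t0 ir r0.
have irt : mu.-integrable `[t, +oo[ (EFin \o r).
  by apply: integrableS ir => // x /=; rewrite !in_itv/= !andbT; exact: le_trans.
have mrt : measurable_fun `[t, +oo[ r.
  by apply/measurable_EFinP; exact: measurable_int irt.
have rt0 x : t <= x -> 0 <= r x by move=> tx; apply/r0/(le_trans t0).
have E := ge0_integral_shift mrt rt0.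
split.
  apply/integrableP; split.
    apply/measurable_EFinP.
    apply: (measurable_comp (F := `[t, +oo[%classic) (f := r)
      (g := (fun x => x + t) : measurableTypeR R -> measurableTypeR R)) => //.
      by move=> _ [x /= + <-]; rewrite !in_itv/= !andbT lerDr.
    exact: measurable_funTS (measurable_shift t).
  move/integrableP : irt => [_]; congr (_ < _)%E.
  transitivity (\int[mu]_(x in `[t, +oo[) (r x)%:E)%E.
    apply: eq_integral => x; rewrite inE/= in_itv/= andbT => tx.
    by rewrite ger0_norm// rt0.
  rewrite E; apply: eq_integral => x; rewrite inE/= in_itv/= andbT => x0.
  by rewrite ger0_norm// rt0// lerDr.
have -> : \int[mu]_(x in `[0, +oo[) r (x + t) = \int[mu]_(x in `[t, +oo[) r x.
  by rewrite /Rintegral E.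
have := @Rintegral_itvB R r (BLeft 0) +oo%O t ir.
rewrite bnd_simp => /(_ t0 isT).
rewrite Rintegral_itv_obnd_cbnd; last first.
  by apply: integrableS irt => // x /=; rewrite !in_itv/= !andbT => /ltW.
by move=> <-; rewrite addrC subrK.
Qed.

(** Monotone convergence along the intervals [[0, i]] turns a bound uniform in the horizon into
    integrability. *)
Lemma ge0_integrable_bounded (r : R -> R) (B : R) :
  continuous (fun t : R => r (Num.max 0 t)) -> (forall x, 0 <= x -> 0 <= r x) ->
  (forall t, 0 <= t -> \int[mu]_(x in `[0, t]) r x <= B) ->
  mu.-integrable `[0, +oo[ (EFin \o r) /\ \int[mu]_(x in `[0, +oo[) r x <= B.
Proof.
move=> cr r0 rB.
have mr : measurable_fun (`[0, +oo[%classic : set (measurableTypeR R)) r.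
  apply: (eq_measurable_fun (fun t : R => r (Num.max 0 t))).
    by move=> t; rewrite inE/= in_itv/= andbT => t0; rewrite max_r.
  apply: measurable_funTS.
  exact: (continuous_measurable_fun cr).
have irt (t : R) : mu.-integrable `[0, t] (EFin \o r).
  apply: continuous_compact_integrable; first exact: segment_compact.
  exact: within_continuous_clamp.
have U : \bigcup_i `[(0 : R), i%:R]%classic = `[(0 : R), +oo[%classic.
  apply/seteqP; split=> [x [i _] /=|x /=].
    by rewrite !in_itv/= andbT => /andP[].
  rewrite in_itv/= andbT => x0; exists (Num.trunc x).+1 => //=.
  by rewrite in_itv/= x0 ltW// truncnS_gt.
have Ile : (\int[mu]_(x in `[0%R, +oo[) (r x)%:E <= B%:E)%E.
  have H := @ge0_nondecreasing_set_cvg_integral _ _ R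
    (fun i => `[0, i%:R]%classic : set (measurableTypeR R)) (EFin \o r) mu.
  rewrite U in H; apply: cvge_to_le (H _ _ _ _) _.
  - apply/nondecreasing_seqP => i; rewrite subsetEset => x /=.
    rewrite !in_itv/= => /andP[-> /le_trans]; apply.
    by rewrite ler_nat.
  - by move=> i; exact: measurable_itv.
  - by move=> i; exact: measurable_int (irt _).
  - by move=> i x /=; rewrite in_itv/= lee_fin => /andP[/r0].
  - apply: nearW => i; rewrite -(@fineK _ (\int[mu]_(x in _) _)%E).
      by rewrite lee_fin; exact: rB.
    exact: integrable_fin_num (irt _).
have I0 : (0 <= \int[mu]_(x in `[0%R, +oo[) (r x)%:E)%E.
  by apply: integral_ge0 => x /=; rewrite in_itv/= andbT lee_fin => /r0.
split.
  apply/integrableP; split; first exact/measurable_EFinP.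
  apply: le_lt_trans (ltry B); apply: le_trans Ile.
  rewrite le_eqVlt; apply/orP; left; apply/eqP.
  apply: eq_integral => x; rewrite inE/= in_itv/= andbT => x0.
  by rewrite ger0_norm// r0.
rewrite -lee_fin /Rintegral fineK// ge0_fin_numE//.
exact: le_lt_trans Ile (ltry B).
Qed.

Lemma Rintegral_ge_cst (r : R -> R) (q t : R) : 0 <= t ->
  mu.-integrable `[0, t] (EFin \o r) ->
  (forall x, 0 <= x <= t -> q <= r x) -> q * t <= \int[mu]_(x in `[0, t]) r x.
Proof.
move=> t0 ir qr.
have -> : q * t = \int[mu]_(x in `[0, t]) q.
  rewrite Rintegral_cst//= lebesgue_measure_itv/= lte_fin.
  move: t0; rewrite le_eqVlt => /predU1P[<-|t0]; first by rewrite ltxx mulr0.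
  by rewrite t0 oppr0 adde0.
apply: le_Rintegral => //.
  by apply: continuous_itv_integrable => x; exact: cvg_cst.
Qed.

End half_line_integrals.

(** * Lyapunov's direct method on a compact sublevel set *)

Lemma right_derivative_cvg (R : realType) (V : normedModType R) (gam : R -> V)
    (x v : V) : h^-1 *: (gam h - x) @[h --> 0^'+] --> v ->
  gam h @[h --> 0^'+] --> x.
Proof.
move=> gv.
have : h *: (h^-1 *: (gam h - x)) + x @[h --> 0^'+] --> (0 : R) *: v + x.
  apply: cvgD; last exact: cvg_cst.
  by apply: cvgZ gv; apply: cvg_at_right_filter; exact: cvg_id.
rewrite scale0r add0r; apply: cvg_trans; apply: near_eq_cvg.
near=> h; rewrite scalerA mulfV ?scale1r ?subrK//.
Unshelve. all: by end_near. Qed.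

Lemma continuous_comp_within (S T U : topologicalType) (K : set T)
    (g : S -> T) (l : T -> U) : (forall s, K (g s)) -> continuous g ->
  {within K, continuous l} -> continuous (fun s => l (g s)).
Proof.
move=> Kg cg /subspace_continuousP cl s A /(cl _ (Kg s)) nA.
have H : nbhs s [set x | K (g x) -> A (l (g x))] by exact: (cg s _ nA).
by apply: (filterS _ H) => x /=; apply; exact: Kg.
Qed.

(** [m] is the minimum of [h] on the compact part of [K] outside the [e]-ball, or 1 if that part is
    empty. Applied to [V] it confines trajectories; applied to [l] it gives a dissipation rate. *)
Lemma pos_separation (R : realType) (V : normedModType R) (K : set V)
    (h : V -> R) (e : R) : compact K -> {within K, continuous h} ->
  (forall x, K x -> x != 0 -> 0 < h x) -> 0 < e ->
  exists2 m : R, 0 < m & forall x, K x -> h x < m -> `|x| < e.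
Proof.
move=> cK ch h0 e0.
pose L := K `&` [set x | e <= `|x|].
have cL : compact L.
  apply: (subclosed_compact _ cK); last by move=> x [].
  apply: closedI; first exact: compact_closed (@norm_hausdorff _ _) cK.
  have /continuous_closedP /(_ [set t | e <= t]) := @norm_continuous R V.
  by apply; exact: closed_ge.
have [[z Lz]|L0] := pselect (L !=set0); last first.
  exists 1 => // x Kx _; rewrite ltNge; apply/negP => ex.
  by apply: L0; exists x.
have chL : {within L, continuous h}.
  by apply: continuous_subspaceW ch => x [].
have [p pL minp] := compact_EVT_min (ex_intro _ z Lz) cL chL.
move: pL; rewrite inE => -[Kp ep].
exists (h p); first by apply: h0 => //; rewrite -normr_gt0 (lt_le_trans e0).
move=> x Kx hx; rewrite ltNge; apply/negP => ex.
by move: hx; rewrite ltNge minp// inE.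
Qed.

Section lyapunov.
Context {R : realType} {n : nat}.
Notation mu := (@lebesgue_measure R).
Variables (D E : set 'cV[R]_n) (F : 'cV[R]_n -> 'cV[R]_n).
Variables (V l : 'cV[R]_n -> R) (c : R).
(** [E] will be the set where the value exists. Off it [V] is meaningless, so staying in [K] means
    preserving [E] as well as the bound; [l] will be the running cost of the improved policy. *)
Let K := [set x | E x /\ V x <= c].
Hypothesis KD : K `<=` D.
Hypothesis compact_K : compact K.
Hypothesis nbhs_K : nbhs (0 : 'cV[R]_n) K.
Hypothesis E_diff : forall x, K x ->
  (\forall y \near x, E y) /\ differentiable V x.
Hypothesis V0 : V 0 = 0.
Hypothesis V_gt0 : forall x, K x -> x != 0 -> 0 < V x.
Hypothesis F_lip : [locally [lipschitz F x | x in D]].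
Hypothesis l_cont : {within K, continuous l}.
Hypothesis l_ge0 : forall x, K x -> 0 <= l x.
Hypothesis l_gt0 : forall x, K x -> x != 0 -> 0 < l x.
Hypothesis dVF : forall x, K x -> 'd V x (F x) <= - l x.

Let closed_K : closed K.
Proof. exact: compact_closed (@norm_hausdorff _ _) compact_K. Qed.

Let K_0 : K 0. Proof. exact: nbhs_singleton nbhs_K. Qed.

Let V_ge0 x : K x -> 0 <= V x.
Proof.
by move=> Kx; have [->|x0] := eqVneq x 0; [rewrite V0|exact/ltW/V_gt0].
Qed.

Let V_cont : {within K, continuous V}.
Proof.
apply/subspace_continuousP => x Kx.
apply: cvg_within_filter; apply: differentiable_continuous.
by have [] := E_diff Kx.
Qed.

(** At 0 this is [nbhs_K]. Elsewhere the right derivative of [V] along the curve is at most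
    [- l < 0], so [V] drops at once, even from the level [c]; [E] persists because it holds around
    each point of [K]. *)
Let K_step (gam : R -> 'cV[R]_n) (t : R) : K (gam t) ->
  h^-1 *: (gam (t + h) - gam t) @[h --> 0^'+] --> F (gam t) ->
  \forall h \near 0^'+, K (gam (t + h)).
Proof.
move=> Kg gF.
have gc := right_derivative_cvg (gam := fun h => gam (t + h)) gF.
have [g0|g0] := eqVneq (gam t) 0.
  by rewrite g0 in gc; exact: gc _ nbhs_K.
have [Enbhs dV] := E_diff Kg.
have q := right_derivative_comp (gam := fun h => gam (t + h)) dV gF.
have neg : 'd V (gam t) (F (gam t)) < 0.
  by rewrite (le_lt_trans (dVF Kg))// oppr_lt0; exact: l_gt0.
near=> h; split; first by near: h; exact: gc _ Enbhs.
have h0 : 0 < h by [].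
have : h^-1 * (V (gam (t + h)) - V (gam t)) < 0.
  by near: h; exact: cvgr_lt q _ neg.
rewrite pmulr_rlt0 ?invr_gt0// subr_lt0 => /ltW /le_trans; apply.
exact: Kg.2.
Unshelve. all: by end_near. Qed.

Lemma lyapunov_invariant x phi : K x -> is_trajectory D F x phi ->
  forall t : R, 0 <= t -> K (phi t).
Proof.
move=> Kx tr; apply: closed_forward_invariant => //.
- exact: trajectory_clamp_continuous tr.
- by case: tr => ->.
- by move=> t t0 Kt; apply: K_step => //; exact: trajectory_right_derivative tr t0.
Qed.

(* Invariance of [K] only involves the field on [K], so a global solution for a
   Lipschitz extension of [F] restricted to [K] never leaves [K]. *)
Lemma lyapunov_trajectory_exists x : K x -> trajectory_exists D F x.
Proof.
move=> Kx.
have [L L0 FL] := lipschitz_compact compact_K KD F_lip.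
have [G [GL GF]] := lipschitz_extension (ltW L0) (ex_intro _ x Kx) FL.
have [phi [phi0 dphi]] := picard_lindelof x L0 GL.
have right (t : R) : 0 <= t ->
    h^-1 *: (phi (t + h) - phi t) @[h --> 0^'+] --> G (phi t).
  move=> t0; have [dv <-] := dphi t t0.
  have : h^-1 *: (phi (h *: 1 + t) - phi t) @[h --> 0^'+] --> 'D_1 phi t.
    by apply: cvg_dnbhs_at_right; exact: dv.
  rewrite (_ : (fun h => _) = (fun h => h^-1 *: (phi (t + h) - phi t)))//.
  by apply/funext => h; rewrite [h *: 1]mulr1 [h + t]addrC.
have Kphi (t : R) : 0 <= t -> K (phi t).
  move: t; apply: closed_forward_invariant => //.
  - by apply: continuous_clamp_derivable => t /dphi [].
  - by rewrite phi0.
  - by move=> t t0 Kt; apply: K_step => //; rewrite -GF//; exact: right.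
exists phi; split => //.
- by move=> t t0; exact/KD/Kphi.
- by move=> t t0; rewrite -GF; [exact/dphi/ltW|exact/Kphi/ltW].
- rewrite -GF; last exact: Kphi.
  by have := right 0 (lexx 0); under eq_fun do rewrite add0r.
Qed.

Section along_trajectory.
Variables (x : 'cV[R]_n) (phi : R -> 'cV[R]_n).
Hypotheses (Kx : K x) (tr : is_trajectory D F x phi).

Let Kphi (t : R) : 0 <= t -> K (phi t).
Proof. exact: lyapunov_invariant Kx tr t. Qed.

Let phi0 : phi 0 = x. Proof. by case: tr. Qed.

Let Kclamp (t : R) : K (phi (Num.max 0 t)).
Proof. by apply: Kphi; rewrite le_max lexx. Qed.

Let lphi_cont : continuous (fun t : R => l (phi (Num.max 0 t))).
Proof.
exact: continuous_comp_within Kclamp (trajectory_clamp_continuous tr) l_cont.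
Qed.

Let Vphi_cont : continuous (fun t : R => V (phi (Num.max 0 t))).
Proof.
exact: continuous_comp_within Kclamp (trajectory_clamp_continuous tr) V_cont.
Qed.

Let Vphi_derive (t : R) : 0 < t ->
  is_derive t 1 (fun s => V (phi s)) ('d V (phi t) (F (phi t))).
Proof.
move=> t0; apply: is_derive_comp; first by have [] := E_diff (Kphi (ltW t0)).
by case: tr => _ _ + _; apply.
Qed.

Lemma lyapunov_nonincreasing (s t : R) : 0 <= s -> s <= t ->
  V (phi t) <= V (phi s).
Proof.
move=> s0 st.
have := @ler_derive_increment R (fun t => V (phi t)) (cst 0) s t st.
rewrite subrr subr_le0; apply.
- exact: (within_continuous_clamp (phi := fun t => V (phi t)) s0 Vphi_cont).
- by apply: continuous_subspaceT => ?; exact: cvg_cst.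
- move=> r /andP[sr rt]; have r0 := le_lt_trans s0 sr.
  exists ('d V (phi r) (F (phi r))), 0; split; first exact: Vphi_derive.
    exact: is_derive_cst.
  have Kr := Kphi (ltW r0).
  by rewrite (le_trans (dVF Kr))// oppr_le0; exact: l_ge0.
Qed.

(** [V] along the trajectory is compared with minus a primitive of [l]: the derivative of [V] is
    only bounded above, so it is not itself integrated. *)
Lemma lyapunov_dissipation (T : R) : 0 <= T ->
  V (phi T) + \int[mu]_(t in `[0, T]) l (phi t) <= V x.
Proof.
move=> T0; pose u (t : R) := l (phi (Num.max 0 t)).
pose U s := \int[mu]_(x in `[-1, s]) u x - \int[mu]_(x in `[-1, 0]) u x.
have dU (t : R) : 0 <= t -> is_derive t 1 U (u t).
  by move=> t0; exact: is_derive_primitive.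
have -> : \int[mu]_(t in `[0, T]) l (phi t) = U T.
  rewrite /U primitiveE//; apply: eq_Rintegral => t.
  by rewrite inE/= in_itv/= /u => /andP[t0 _]; rewrite max_r.
have := @ler_derive_increment R (fun t => V (phi t)) (fun t => - U t) 0 T T0.
rewrite phi0 /U subrr oppr0 subr0 -/(U T) => H.
suff : V (phi T) - V x <= - U T by lra.
apply: H.
- exact: (within_continuous_clamp (phi := fun t => V (phi t)) (lexx 0) Vphi_cont).
- apply: (within_continuous_clamp (phi := fun t => - U t)) => //.
  apply: (continuous_clamp_derivable (phi := fun t => - U t)) => t t0.
  by apply: derivableN; have [] := dU t t0.
- move=> t /andP[t0 _]; exists ('d V (phi t) (F (phi t))), (- u t); split.
  + exact: Vphi_derive.
  + by apply: is_deriveN; exact/dU/ltW.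
  + by rewrite /u max_r ?(ltW t0)//; exact/dVF/Kphi/ltW.
Qed.

Lemma lyapunov_integrable :
  mu.-integrable `[0, +oo[ (EFin \o (fun t => l (phi t))) /\
  \int[mu]_(t in `[0, +oo[) l (phi t) <= V x.
Proof.
apply: (ge0_integrable_bounded (r := fun t => l (phi t))) => //.
  by move=> t t0; exact/l_ge0/Kphi.
move=> t t0; apply: le_trans (lyapunov_dissipation t0).
by rewrite lerDr; exact/V_ge0/Kphi.
Qed.

(** Once [V] falls below [m] it stays there, so the norm stays below [e]. If it never did,
    continuity of [V] at 0 would keep the trajectory at distance [d] from 0, hence [l] above some
    [q > 0], and the dissipated amount would exceed [V x]. *)
Lemma lyapunov_cvg0 : phi t @[t --> +oo] --> (0 : 'cV[R]_n).
Proof.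
apply/cvgr0Pnorm_lt => e e0.
have [m m0 Vm] := pos_separation compact_K V_cont V_gt0 e0.
suff [s s0 Vs] : exists2 s : R, 0 <= s & V (phi s) < m.
  near=> t; have st : s <= t by near: t; exact: nbhs_pinfty_ge (num_real s).
  apply: Vm; first by apply: Kphi; exact: le_trans st.
  by apply: le_lt_trans Vs; exact: lyapunov_nonincreasing.
apply: contrapT => nV.
have {}nV (t : R) : 0 <= t -> m <= V (phi t).
  by move=> t0; rewrite leNgt; apply/negP => ltm; apply: nV; exists t.
have cV0 : V y @[y --> (0 : 'cV[R]_n)] --> 0.
  by rewrite -V0; apply: differentiable_continuous; have [] := E_diff K_0.
have : \forall y \near (0 : 'cV[R]_n), V y < m by exact: cvgr_lt cV0 _ m0.
move=> /nbhs_normP [d /= d0 dV].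
have phid (t : R) : 0 <= t -> d <= `|phi t|.
  move=> t0; rewrite leNgt; apply/negP => ptd.
  have : V (phi t) < m by apply: dV; rewrite /ball_/= sub0r normrN.
  by rewrite ltNge nV.
have [q q0 lq] := pos_separation compact_K l_cont l_gt0 d0.
have lphi (t : R) : 0 <= t -> q <= l (phi t).
  move=> t0; rewrite leNgt; apply/negP => /(lq _ (Kphi t0)).
  by rewrite ltNge phid.
(* By this time at least [q * T = V x + q] has been dissipated, more than is available. *)
pose T := V x / q + 1.
have T0 : 0 <= T by rewrite addr_ge0// divr_ge0 ?(ltW q0)//; exact: V_ge0.
have := lyapunov_dissipation T0.
have : q * T <= \int[mu]_(t in `[0, T]) l (phi t).
  apply: Rintegral_ge_cst => //; last by move=> t /andP[t0 _]; exact: lphi.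
  apply: integrableS lyapunov_integrable.1 => // t /=.
  by rewrite !in_itv/= => /andP[->].
have -> : q * T = V x + q by rewrite /T mulrDr mulr1 mulrC divfK// gt_eqF.
have := V_ge0 (Kphi T0); lra.
Unshelve. all: by end_near. Qed.

End along_trajectory.

(** A ball inside both [K] and the set [V < m] provides existence, by [lyapunov_trajectory_exists],
    and confinement, by monotonicity of [V]. *)
Lemma lyapunov_stable : stable D F.
Proof.
move=> e e0.
have [m m0 Vm] := pos_separation compact_K V_cont V_gt0 e0.
have cV0 : V y @[y --> (0 : 'cV[R]_n)] --> 0.
  by rewrite -V0; apply: differentiable_continuous; have [] := E_diff K_0.
have : \forall y \near (0 : 'cV[R]_n), K y /\ V y < m.
  by near=> y; split; near: y; [exact: nbhs_K|exact: cvgr_lt cV0 _ m0].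
move=> /nbhs_normP [d /= d0 dP]; exists d => // x0 _ x0d.
have [Kx0 Vx0] : K x0 /\ V x0 < m by apply: dP; rewrite /ball_/= sub0r normrN.
have ex := lyapunov_trajectory_exists Kx0.
split=> // t t0.
have tr : is_trajectory D F x0 (trajectory D F x0) by exact: getPex ex.
apply: Vm; first exact: lyapunov_invariant tr t t0.
apply: le_lt_trans Vx0.
have := lyapunov_nonincreasing Kx0 tr (lexx 0) t0.
by case: tr => ->.
Unshelve. all: by end_near. Qed.

End lyapunov.

(** * Matrix limits, quadratic forms and gradients *)

Lemma cvg_big_sum (R : realType) (I T : Type) (F : set_system T)
    (r : seq I) (f : I -> T -> R) (a : I -> R) {FF : Filter F} :
  (forall i, f i @ F --> a i) ->
  \sum_(i <- r) f i t @[t --> F] --> \sum_(i <- r) a i.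
Proof.
move=> fa; elim: r => [|i r ih].
  by under eq_fun do rewrite big_nil; rewrite big_nil; exact: cvg_cst.
by under eq_fun do rewrite big_cons; rewrite big_cons; apply: cvgD.
Qed.

Lemma cvg_mulmx (R : realType) (p q s : nat) (T : Type) (F : set_system T)
    (A : T -> 'M[R]_(p, q)) (B : T -> 'M[R]_(q, s))
    (a : 'M[R]_(p, q)) (b : 'M[R]_(q, s))
    {FF : Filter F} :
  A @ F --> a -> B @ F --> b -> A t *m B t @[t --> F] --> a *m b.
Proof.
move=> /cvg_mxP Aa /cvg_mxP Bb; apply/cvg_mxP => i j.
under eq_fun do rewrite mxE; rewrite mxE; apply: cvg_big_sum => k.
exact: cvgM.
Qed.

Lemma cvg_trmx (R : realType) (p q : nat) (T : Type) (F : set_system T)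
    (A : T -> 'M[R]_(p, q)) (a : 'M[R]_(p, q))
    {FF : Filter F} :
  A @ F --> a -> (A t)^T @[t --> F] --> a^T.
Proof.
move=> /cvg_mxP Aa; apply/cvg_mxP => i j.
by under eq_fun do rewrite mxE; rewrite mxE; exact: Aa.
Qed.

Lemma lipschitz_within_continuous (R : realType) (V W : normedModType R)
    (D : set V) (g : V -> W) :
  [locally [lipschitz g x | x in D]] -> {within D, continuous g}.
Proof.
move=> glip; apply/subspace_continuousP => x Dx.
have /pinfty_ex_gt0 [M M0] := glip (x, x) (conj Dx Dx).
rewrite /dominated_by /within/= => -[[A B] /= [Ax Bx] AB].
apply/(@cvgrPdist_le _ _ _ (within D (nbhs x))) => e e0.
have dx : \forall y \near x, `|x - y| <= M^-1 * e.
  apply/nbhs_normP; exists (M^-1 * e) => /=; first by rewrite mulr_gt0// invr_gt0.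
  by move=> y /ltW.
rewrite near_withinE; apply: (filterS _ (filterI Bx dx)) => y [By xy] Dy.
have /= le : `|g x - g y| <= M * `|x - y|.
  by apply: (AB (x, y)) => //=; split=> //; exact: nbhs_singleton Ax.
by rewrite (le_trans le)// -ler_pdivlMl.
Qed.

Section quadratic_form.
Context {R : realType} {m : nat}.
Variable W : 'M[R]_m.
Hypothesis W_posdef : posdefmx W.

Lemma posdefmx_ge0 (u : 'cV[R]_m) : 0 <= (u^T *m W *m u) 0 0.
Proof.
have [->|u0] := eqVneq u 0; first by rewrite mulmx0 mxE.
exact/ltW/W_posdef.2.
Qed.

Lemma posdefmx_unit : W \in unitmx.
Proof.
rewrite -row_free_unit -kermx_eq0; apply/negP => /negP.
move=> /rowV0Pn [v /sub_kermxP vW v0].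
have := W_posdef.2 v^T; rewrite trmxK vW mul0mx mxE ltxx => H.
suff : false by [].
by apply: H; apply: contraNneq v0 => E; rewrite -(trmxK v) E trmx0 eqxx.
Qed.

Lemma posdefmx_sym (a b : 'cV[R]_m) :
  (a^T *m W *m b) 0 0 = (b^T *m W *m a) 0 0.
Proof.
have -> : (a^T *m W *m b) 0 0 = ((a^T *m W *m b)^T) 0 0 by rewrite [RHS]mxE.
by rewrite !trmx_mul trmxK W_posdef.1 mulmxA.
Qed.

(* Completing the square: the improved policy [b] minimizes the Hamiltonian,
   the excess of any other policy [a] being [(b - a)^T W (b - a)]. *)
Lemma posdefmx_complete_square (a b : 'cV[R]_m) :
  - (a^T *m W *m a) 0 0 - 2 * (b^T *m W *m (b - a)) 0 0 <=
  - (b^T *m W *m b) 0 0.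
Proof.
have := posdefmx_ge0 (b - a).
have -> : (b - a)^T *m W *m (b - a) = b^T *m W *m b - b^T *m W *m a -
    (a^T *m W *m b - a^T *m W *m a).
  have -> : (b - a)^T = b^T - a^T by rewrite linearB.
  by rewrite !mulmxBl !mulmxBr.
have sub00 (x y : 'M[R]_1) : (x - y) 0 0 = x 0 0 - y 0 0 by rewrite !mxE.
rewrite mulmxBr !sub00 (posdefmx_sym a b); lra.
Qed.

End quadratic_form.

Lemma diff_gradient (R : realType) (n : nat) (V : 'cV[R]_n -> R)
    (x v : 'cV[R]_n) : differentiable V x ->
  'd V x v = ((gradient V x)^T *m v) 0 0.
Proof.
move=> dV; rewrite mxE.
have -> : v = \sum_i v i 0 *: delta_mx i 0.
  rewrite {1}[v]matrix_sum_delta; apply: eq_bigr => i _.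
  by rewrite big_ord_recl big_ord0 addr0.
rewrite linear_sum/=; apply: eq_bigr => i _.
rewrite linearZ/= -deriveE// !mxE [LHS]mulrC; congr (_ * _).
rewrite summxE (bigD1 i)//= !mxE !eqxx mulr1 big1 ?addr0// => j ji.
by rewrite !mxE eq_sym (negbTE ji) mulr0.
Qed.

(** Difference quotients along the ray [x + h *: v] are nonnegative, so ['d V x v >= 0] for every
    [v]; replacing [v] by [- v] gives equality. *)
Lemma gradient_min (R : realType) (n : nat) (V : 'cV[R]_n -> R)
    (x : 'cV[R]_n) : differentiable V x -> (\forall y \near x, V x <= V y) ->
  gradient V x = 0.
Proof.
move=> dV Vmin.
have ge v : 0 <= 'd V x v.
  pose gam (h : R) := x + h *: v.
  have gx : h^-1 *: (gam h - x) @[h --> 0^'+] --> v.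
    apply/cvgrPdist_le => e e0; near=> h.
    rewrite /gam addrAC subrr add0r scalerA mulVf ?gt_eqF// scale1r.
    by rewrite subrr normr0 ltW.
  have gc := right_derivative_cvg gx.
  apply: (cvgr_to_ge (right_derivative_comp dV gx)); near=> h.
  rewrite mulr_ge0 ?invr_ge0// subr_ge0.
  by near: h; exact: gc _ Vmin.
apply/colP => i; rewrite !mxE deriveE//; apply/eqP; rewrite eq_le ge andbT.
by rewrite -oppr_ge0 -linearN; exact: ge.
Unshelve. all: by end_near. Qed.

(** * Time translation and the value function of one policy *)

Lemma is_derive_translate (R : realType) (V : normedModType R) (phi : R -> V)
    (s t : R) (v : V) :
  is_derive (s + t) 1 phi v -> is_derive s 1 (fun u => phi (u + t)) v.
Proof.
have E : (fun h : R => h^-1 *: (phi (h *: 1 + s + t) - phi (s + t))) =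
    (fun h : R => h^-1 *: (phi (h *: 1 + (s + t)) - phi (s + t))).
  by apply/funext => h; rewrite addrA.
move=> [dphi phiE]; split; first by rewrite /derivable/= E; exact: dphi.
by rewrite -phiE /derive/= E.
Qed.

Lemma trajectory_translate (R : realType) (n : nat) (D : set 'cV[R]_n)
    (F : 'cV[R]_n -> 'cV[R]_n) (x : 'cV[R]_n) (phi : R -> 'cV[R]_n) (t : R) :
  is_trajectory D F x phi -> 0 <= t ->
  is_trajectory D F (phi t) (fun s => phi (s + t)).
Proof.
move=> tr t0; split.
- by rewrite add0r.
- by case: tr => _ Dphi _ _ s s0; apply: Dphi; rewrite addr_ge0.
- move=> s s0; apply: is_derive_translate.
  by case: tr => _ _ + _; apply; rewrite ltr_wpDr.
- rewrite add0r; have := trajectory_right_derivative tr t0.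
  have -> // : (fun h => h^-1 *: (phi (t + h) - phi t)) =
    (fun h => h^-1 *: (phi (h + t) - phi t)).
  by apply/funext => h; rewrite [h + t]addrC.
Qed.

Section value_function.
Context {R : realType} {n m : nat}.
Notation mu := (@lebesgue_measure R).
Variables (D : set 'cV[R]_n) (f : 'cV[R]_n -> 'cV[R]_n).
Variables (g : 'cV[R]_n -> 'M[R]_(n, m)) (Q : 'cV[R]_n -> R) (W : 'M[R]_m).
Hypothesis D_region : region D D.
Hypothesis f0 : f 0 = 0.
Hypothesis g_lip : [locally [lipschitz g x | x in D]].
Hypothesis Q_cont : {within D, continuous Q}.
Hypothesis Q0 : Q 0 = 0.
Hypothesis Q_gt0 : forall x, D x -> x != 0 -> 0 < Q x.
Hypothesis W_posdef : posdefmx W.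

Let D0 : D 0. Proof. by case: D_region => _ + _; exact: nbhs_singleton. Qed.

Let cost_geQ x u : Q x <= cost Q W x u.
Proof. by rewrite /cost lerDl; exact: posdefmx_ge0. Qed.

Let cost_ge0 x u : D x -> 0 <= cost Q W x u.
Proof.
move=> Dx; apply: le_trans (cost_geQ x u).
by have [->|x0] := eqVneq x 0; [rewrite Q0|exact/ltW/Q_gt0].
Qed.

Let cost_within_continuous (A : set 'cV[R]_n) (u : 'cV[R]_n -> 'cV[R]_m) :
  A `<=` D -> {within A, continuous u} ->
  {within A, continuous (fun x => cost Q W x (u x))}.
Proof.
move=> AD cu; have cQ := continuous_subspaceW AD Q_cont.
have cq : {within A, continuous (fun x => ((u x)^T *m W *m u x) 0 0)}.
  move=> x; have cux : u @ nbhs (x : subspace A) --> u x := cu x.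
  have /cvg_mxP : (u y)^T *m W *m u y @[y --> nbhs (x : subspace A)] -->
      (u x)^T *m W *m u x.
    by apply: (cvg_mulmx _ cux); apply: (cvg_mulmx (cvg_trmx cux)); exact: cvg_cst.
  exact.
by move=> x; exact: (cvgD (cQ x) (cq x)).
Qed.

Section one_policy.
Variable u : 'cV[R]_n -> 'cV[R]_m.
Notation F := (closed_loop f g u).
Notation V := (value D f g Q W u).
Notation E := (value_exists D f g Q W u).
Notation phi := (trajectory D F).
Notation rho := (running_cost D f g Q W u).
Hypothesis F_lip : [locally [lipschitz F x | x in D]].

Let phiP x : trajectory_exists D F x -> is_trajectory D F x (phi x).
Proof. exact: getPex. Qed.

Let rho_ge0 x (t : R) : trajectory_exists D F x -> 0 <= t -> 0 <= rho x t.
Proof. by move=> /phiP [_ Dphi _ _] t0; apply/cost_ge0/Dphi. Qed.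

Lemma value_ge0 x : E x -> 0 <= V x.
Proof.
move=> [ex _]; apply: Rintegral_ge0 => t /=; rewrite in_itv/= andbT => t0.
exact: rho_ge0.
Qed.

(** Bellman's identity. The chosen trajectory from [phi x t] equals the translate of the one from
    [x] by uniqueness, so the costs match and the integral can be cut at [t]. *)
Lemma value_along_trajectory x (t : R) : E x -> 0 <= t ->
  E (phi x t) /\ V x = \int[mu]_(s in `[0, t]) rho x s + V (phi x t).
Proof.
move=> [ex irho] t0.
have tr := trajectory_translate (phiP ex) t0.
have ext : trajectory_exists D F (phi x t) by exists (fun s => phi x (s + t)).
have rhoE (s : R) : 0 <= s -> rho (phi x t) s = rho x (s + t).
  by move=> s0; rewrite /running_cost (trajectory_unique F_lip (phiP ext) tr).
have [it itE] := ge0_Rintegral_split_shift t0 irho (fun s => rho_ge0 ex).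
split.
  split => //; apply: eq_integrable it => // s.
  by rewrite inE/= in_itv/= andbT => s0; rewrite rhoE.
rewrite /value itE; congr (_ + _); apply: eq_Rintegral => s.
by rewrite inE/= in_itv/= andbT => s0; rewrite rhoE.
Qed.

(** By continuity [Q] exceeds [Q x / 2] along the trajectory during a time [d / 2]; the value
    remaining afterwards is nonnegative. *)
Lemma value_gt0 x : E x -> x != 0 -> 0 < V x.
Proof.
move=> Ex x0; have [ex irho] := Ex.
have tr := phiP ex; have [phi0 Dphi _ _] := tr.
have Qc : continuous (fun t : R => Q (phi x (Num.max 0 t))).
  apply: continuous_comp_within (trajectory_clamp_continuous tr) Q_cont => t.
  by apply: Dphi; rewrite le_max lexx.
have Qx : 0 < Q x by apply: Q_gt0 => //; rewrite -phi0; exact: Dphi.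
have : \forall t \near (0 : R), Q x / 2 < Q (phi x (Num.max 0 t)).
  apply: cvgr_gt (Qc 0) _ _; rewrite maxxx phi0; lra.
move=> /nbhs_normP [d /= d0 dQ].
have d20 : 0 <= d / 2 by rewrite divr_ge0// ltW.
have [Et ->] := value_along_trajectory Ex d20.
rewrite ltr_pwDl//; last exact: value_ge0.
apply: (@lt_le_trans _ _ (Q x / 2 * (d / 2))).
  by rewrite mulr_gt0// divr_gt0.
apply: Rintegral_ge_cst => //.
  by apply: integrableS irho => // t /=; rewrite !in_itv/= => /andP[->].
move=> t /andP[t0 td]; apply: le_trans (cost_geQ _ _).
apply: ltW; have := dQ t; rewrite max_r//; apply.
rewrite /ball_/= sub0r normrN ger0_norm//; lra.
Qed.

Lemma value_at0 : u 0 = 0 -> E 0 -> V 0 = 0.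
Proof.
move=> u0 [ex _]; have F0 : F 0 = 0 by rewrite /closed_loop f0 u0 mulmx0 addr0.
have tr0 : is_trajectory D F 0 (cst 0).
  split=> //.
  - by move=> t _; rewrite F0; exact: is_derive_cst.
  - rewrite F0; under eq_fun do rewrite subrr scaler0; exact: cvg_cst.
transitivity (\int[mu]_(t in `[0, +oo[) (0 : R)); last first.
  by rewrite /Rintegral integral0.
apply: eq_Rintegral => t; rewrite inE/= in_itv/= andbT => t0.
rewrite /running_cost (trajectory_unique F_lip (phiP ex) tr0 t0).
by rewrite /cost u0 Q0 mulmx0 mxE addr0.
Qed.

(** [V] loses the integral of [rho] over [[0, h]], at least [(rho x 0 - e) * h] for small [h]. The
    trajectory must stay in [Omega], where [u] is continuous, for [rho] to be continuous at time
    0. *)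
Lemma value_hamiltonian (Omega : set 'cV[R]_n) x :
  Omega `<=` D -> {within Omega, continuous u} ->
  E x -> differentiable V x -> (forall t : R, 0 <= t -> Omega (phi x t)) ->
  'd V x (F x) <= - cost Q W x (u x).
Proof.
move=> OD cu Ex dV Ophi; have [ex irho] := Ex.
have tr := phiP ex; have [phi0 Dphi _ _] := tr.
have rhoc : continuous (fun t : R => rho x (Num.max 0 t)).
  apply: (@continuous_comp_within _ _ _ Omega (fun t : R => phi x (Num.max 0 t))
    (fun y => cost Q W y (u y))).
  - by move=> t; apply: Ophi; rewrite le_max lexx.
  - exact: trajectory_clamp_continuous tr.
  - exact: cost_within_continuous.
have rho0 : rho x 0 = cost Q W x (u x) by rewrite /running_cost phi0.
apply/ler_addgt0Pr => e e0; rewrite addrC -lerBlDr.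
have := trajectory_right_derivative tr (lexx 0).
under eq_fun do rewrite add0r; rewrite phi0.
move=> /(right_derivative_comp dV) q; rewrite lerBlDr.
have : \forall t \near (0 : R), rho x 0 - e < rho x (Num.max 0 t).
  apply: cvgr_gt (rhoc 0) _ _; rewrite maxxx; lra.
move=> /nbhs_normP [d /= d0 dr].
apply: (cvgr_to_le q); near=> h.
have h0 : 0 < h by [].
have hd : h < d by near: h; exact: nbhs_right_lt.
have [_ Vx] := value_along_trajectory Ex (ltW h0).
have : (rho x 0 - e) * h <= \int[mu]_(s in `[0, h]) rho x s.
  apply: Rintegral_ge_cst; first exact: ltW.
    by apply: integrableS irho => // t /=; rewrite !in_itv/= => /andP[->].
  move=> t /andP[t0 th]; apply: ltW; have := dr t; rewrite max_r//; apply.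
  by rewrite /ball_/= sub0r normrN ger0_norm// (le_lt_trans th).
rewrite ler_pdivrMl// mulrC -rho0; lra.
Unshelve. all: by end_near. Qed.

End one_policy.

(** * One policy improvement step *)

Section improvement_step.
Variables (u w : 'cV[R]_n -> 'cV[R]_m) (Omega : set 'cV[R]_n) (c : R).
Notation F := (closed_loop f g u).
Notation V := (value D f g Q W u).
Notation E := (value_exists D f g Q W u).
Notation phi := (trajectory D F).
Notation K := (value_sublevel D f g Q W u c).
Hypothesis u_lip : [locally [lipschitz closed_loop f g u x | x in D]].
Hypothesis w_lip : [locally [lipschitz closed_loop f g w x | x in D]].
Hypothesis compact_Omega : compact Omega.
Hypothesis u_adm : admissible D f g Q W u Omega.
Hypothesis V_C1 : value_C1 D f g Q W u Omega.
Hypothesis wE : forall x, Omega x ->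
  w x = - 2^-1 *: (invmx W *m (g x)^T *m gradient V x).
Hypothesis c0 : 0 < c.
Hypothesis K_sub : K `<=` Omega.

Let OD : Omega `<=` D. Proof. by case: u_adm => [[[]]]. Qed.

Let u_cont : {within Omega, continuous u}. Proof. by case: u_adm => [[]]. Qed.

Let u0 : u 0 = 0. Proof. by case: u_adm => [[]]. Qed.

Let O0 : Omega 0.
Proof. by case: u_adm => [[[_ + _] _ _] _ _ _]; exact: nbhs_singleton. Qed.

Let E_Omega x : Omega x -> E x. Proof. by case: u_adm => _ _ _; apply. Qed.

Let V_diff x : Omega x -> differentiable V x.
Proof. by move=> Ox; have [/(_ x Ox) []] := V_C1. Qed.

Let E_nbhs x : Omega x -> \forall y \near x, E y.
Proof. by move=> Ox; have [/(_ x Ox) []] := V_C1. Qed.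

Let V0 : V 0 = 0. Proof. exact: value_at0 u_lip u0 (E_Omega O0). Qed.

Let phiP x : K x -> is_trajectory D F x (phi x).
Proof. by move=> [[ex _] _]; exact: getPex ex. Qed.

Lemma sublevel_invariant x (t : R) : K x -> 0 <= t -> K (phi x t).
Proof.
move=> [Ex Vx] t0; have [Et VE] := value_along_trajectory u_lip Ex t0.
split; first exact: Et.
apply: le_trans Vx; rewrite VE lerDr.
apply: Rintegral_ge0 => s /=; rewrite in_itv/= => /andP[s0 _].
by case: Ex => ex _; apply: cost_ge0; case: (getPex ex) => _ + _ _; apply.
Qed.

(** A limit point of [K] lies in the compact [Omega], where the value exists and [V] is continuous
    in the full neighbourhood sense; [c < V x] would then persist nearby and contradict
    adherence. *)
Lemma compact_sublevel : compact K.
Proof.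
apply: (subclosed_compact _ compact_Omega K_sub) => x Kx.
have Ox : Omega x.
  apply: (compact_closed (@norm_hausdorff _ _) compact_Omega).
  exact: closure_subset K_sub _ Kx.
split; first exact: E_Omega.
rewrite leNgt; apply/negP => cx.
have cV : V y @[y --> x] --> V x by exact/differentiable_continuous/V_diff.
have : \forall y \near x, c < V y by exact: cvgr_gt cV _ cx.
by move=> /Kx [y [[_ Vy]]] /=; rewrite ltNge Vy.
Qed.

Lemma nbhs_sublevel : nbhs (0 : 'cV[R]_n) K.
Proof.
have : V y @[y --> (0 : 'cV[R]_n)] --> V 0.
  exact/differentiable_continuous/V_diff.
rewrite V0 => V_0.
have lt : \forall y \near (0 : 'cV[R]_n), V y < c by exact: cvgr_lt V_0 _ c0.
by apply: (filterS _ (filterI (E_nbhs O0) lt)) => y [Ey /ltW].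
Qed.

(** Each point of [K] is joined to 0 inside [K]: its trajectory under [u] is followed until it
    enters a ball contained in [K], then a straight segment leads to 0. *)
Lemma connected_sublevel : connected K.
Proof.
have /nbhs_normP [d /= d0 dK] := nbhs_sublevel.
have dK' y : `|y| < d -> K y by move=> yd; apply: dK; rewrite /ball_/= sub0r normrN.
have arc x : K x -> exists A : set 'cV[R]_n,
    [/\ A x, A 0, A `<=` K & connected A].
  move=> Kx; have tr := phiP Kx.
  have := u_adm => -[_ [_ _ phi_cvg] _ _].
  have [T T0 Td] : exists2 T : R, 0 <= T & `|phi x T| < d.
    have /cvgr0Pnorm_lt /(_ d d0) := phi_cvg x (K_sub Kx).
    move=> /pinfty_ex_gt0 [T T0 Td]; exists T; [exact: ltW|exact: Td].
  exists (phi x @` `[0, T] `|` (fun s : R => s *: phi x T) @` `[0, 1]); split.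
  - by left; exists 0; [rewrite /= in_itv/= lexx|case: tr].
  - by right; exists 0; [rewrite /= in_itv/= lexx ler01|rewrite scale0r].
  - move=> _ [[t /= + <-]|[s /= + <-]]; rewrite in_itv/= => /andP[t0 t1].
      exact: sublevel_invariant.
    apply: dK'; rewrite normrZ ger0_norm// (le_lt_trans _ Td)//.
    by rewrite ler_piMl.
  - apply: connectedU.
    + exists (phi x T); split; first by exists T; rewrite //= in_itv/= T0 lexx.
      by exists 1; [rewrite /= in_itv/= lexx ler01|rewrite scale1r].
    + apply: connected_continuous_connected; first exact: segment_connected.
      apply: within_continuous_clamp => //.
      exact: trajectory_clamp_continuous tr.
    + apply: connected_continuous_connected; first exact: segment_connected.
      apply: continuous_subspaceT => s.
      by apply: cvgZr_tmp; exact: cvg_id.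
have {}arc x : exists A : set 'cV[R]_n,
    K x -> [/\ A x, A 0, A `<=` K & connected A].
  by have [Kx|] := pselect (K x); [have [A AP] := arc x Kx; exists A|exists set0].
have [A AP] := choice arc.
have -> : K = \bigcup_(x in K) A x.
  apply/seteqP; split=> [x Kx|y [x Kx Ay]].
    by exists x; [exact: Kx|have [] := AP x Kx].
  by have [_ _ AK _] := AP x Kx; exact: AK Ay.
apply: bigcup_connected => [|x Kx]; last by have [] := AP x Kx.
by exists 0 => x Kx; have [] := AP x Kx.
Qed.

Lemma region_sublevel : region D K.
Proof.
split; first exact: subset_trans K_sub OD.
  exact: nbhs_sublevel.
exact: connected_sublevel.
Qed.

Lemma sublevel_admissible : invariantly_admissible D f g Q W u K.
Proof.
have := u_adm => -[_ [ex st cvg0] feas _]; split.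
  split.
  - split=> //; first exact: region_sublevel.
    exact: continuous_subspaceW K_sub u_cont.
  - by split=> // x /K_sub; [exact: ex|exact: cvg0].
  - by move=> x /K_sub; exact: feas.
  - by move=> x [].
by move=> x Kx t t0; exact: sublevel_invariant.
Qed.

Lemma improved_at0 : w 0 = 0.
Proof.
rewrite wE// gradient_min ?mulmx0 ?scaler0//; first exact: V_diff.
by rewrite V0; apply: filterS (E_nbhs O0) => y; exact: value_ge0.
Qed.

Lemma improved_continuous : {within Omega, continuous w}.
Proof.
apply: (@subspace_eq_continuous _ _ _
    (fun x => - 2^-1 *: (invmx W *m (g x)^T *m gradient V x))).
  by move=> x; rewrite inE => /wE.
move=> x.
have cG : gradient V @ nbhs (x : subspace Omega) --> gradient V x := V_C1.2 x.
have cg : g @ nbhs (x : subspace Omega) --> g x.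
  exact: continuous_subspaceW OD (lipschitz_within_continuous g_lip) x.
have cM : (invmx W *m (g y)^T *m gradient V y)
    @[y --> nbhs (x : subspace Omega)] -->
    invmx W *m (g x)^T *m gradient V x.
  by apply: (cvg_mulmx _ cG); apply: (cvg_mulmx _ (cvg_trmx cg)); exact: cvg_cst.
have ca : (cst (- 2^-1) : 'cV[R]_n -> R) @ nbhs (x : subspace Omega) -->
    (- 2^-1 : R) by exact: cvg_cst.
exact: cvgZ ca cM.
Qed.

Lemma improved_hamiltonian x : K x ->
  'd V x (closed_loop f g w x) <= - cost Q W x (w x).
Proof.
move=> Kx; have Ox := K_sub Kx.
have := value_hamiltonian u_lip OD u_cont (E_Omega Ox) (V_diff Ox)
  (fun t t0 => K_sub (sublevel_invariant Kx t0)).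
(* The improvement formula transposed and solved for the gradient term, by symmetry and
   invertibility of [W]. *)
have gw : (gradient V x)^T *m g x = - 2 *: ((w x)^T *m W).
  rewrite wE// linearZ/= !trmx_mul trmxK trmx_inv W_posdef.1 -scalemxAl scalerA.
  rewrite mulmxA mulmxKV ?posdefmx_unit//.
  by rewrite mulrNN divff ?scale1r// pnatr_eq0.
(* Changing [u] into [w] thus adds [- 2 * (w^T W (w - u))] to the derivative of [V], exactly the
   cross term in [posdefmx_complete_square]. *)
have -> : closed_loop f g w x = closed_loop f g u x + g x *m (w x - u x).
  by rewrite /closed_loop mulmxBr -addrA; congr (_ + _); rewrite addrC subrK.
rewrite [in X in _ -> X]linearD/= (diff_gradient (g x *m (w x - u x)) (V_diff Ox)).
rewrite mulmxA gw -scalemxAl.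
have := posdefmx_complete_square W_posdef (u x) (w x).
have sc (k : R) (M : 'M[R]_1) : (k *: M) 0 0 = k * M 0 0 by rewrite mxE.
rewrite /cost sc; lra.
Qed.

(** Compactness of [K] is part of the conclusion because [K] is the next region, and a step starts
    from a compact one. *)
Lemma improvement_step :
  [/\ compact K, policy D w K,
      invariantly_admissible D f g Q W u K /\
      invariantly_admissible D f g Q W w K,
      (forall x, K x -> value D f g Q W w x <= V x) &
      (forall x, K x -> x != 0 -> 0 < value D f g Q W w x)].
Proof.
have KD : K `<=` D := subset_trans K_sub OD.
have ED x : K x -> (\forall y \near x, E y) /\ differentiable V x.
  by move=> /K_sub Ox; split; [exact: E_nbhs|exact: V_diff].
have Vpos x : K x -> x != 0 -> 0 < V x by move=> [Ex _]; exact: value_gt0.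
have w_cont : {within K, continuous w}.
  exact: continuous_subspaceW K_sub improved_continuous.
have lc := cost_within_continuous KD w_cont.
have l0 x : K x -> 0 <= cost Q W x (w x) by move=> /KD; exact: cost_ge0.
have lpos x : K x -> x != 0 -> 0 < cost Q W x (w x).
  by move=> /KD Dx x0; apply: lt_le_trans (cost_geQ _ _); exact: Q_gt0.
have dV := improved_hamiltonian.
have pol : policy D w K by split; [exact: region_sublevel| |exact: improved_at0].
have ex x : K x -> trajectory_exists D (closed_loop f g w) x.
  exact: lyapunov_trajectory_exists KD compact_sublevel nbhs_sublevel ED w_lip
    lpos dV x.
have trP x : K x -> is_trajectory D (closed_loop f g w) x
    (trajectory D (closed_loop f g w) x).
  by move=> Kx; exact: getPex (ex x Kx).
have int x (Kx : K x) := lyapunov_integrable compact_sublevel nbhs_sublevel ED V0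
  Vpos lc l0 lpos dV Kx (trP x Kx).
have wex x : K x -> value_exists D f g Q W w x.
  by move=> Kx; split; [exact: ex|exact: (int x Kx).1].
split.
- exact: compact_sublevel.
- exact: pol.
- split; first exact: sublevel_admissible.
  split; last first.
    move=> x Kx t t0.
    exact: lyapunov_invariant compact_sublevel nbhs_sublevel ED lpos dV _ _ Kx
      (trP x Kx) t t0.
  split; [exact: pol| | |exact: wex].
  + split; first exact: ex.
      exact: lyapunov_stable KD compact_sublevel nbhs_sublevel ED V0 Vpos w_lip
        l0 lpos dV.
    move=> x Kx.
    exact: lyapunov_cvg0 compact_sublevel nbhs_sublevel ED V0 Vpos lc l0 lpos dV
      _ _ Kx (trP x Kx).
  + by move=> x Kx t t0; case: (trP x Kx) => _ + _ _; apply.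
- by move=> x Kx; exact: (int x Kx).2.
- by move=> x Kx x0; apply: value_gt0 => //; exact: wex.
Qed.

End improvement_step.

End value_function.

(** * Induction along the iteration *)

Theorem theorem3 (R : realType) (n m : nat) (D : set 'cV[R]_n)
    (f : 'cV[R]_n -> 'cV[R]_n) (g : 'cV[R]_n -> 'M[R]_(n, m))
    (Q : 'cV[R]_n -> R) (W : 'M[R]_m)
    (mu : nat -> 'cV[R]_n -> 'cV[R]_m)
    (Omega : nat -> set 'cV[R]_n) (c : nat -> R)
    (D_region : region D D)
    (f0 : f 0 = 0)
    (f_lip : [locally [lipschitz f x | x in D]])
    (g_lip : [locally [lipschitz g x | x in D]])
    (Q_cont : {within D, continuous Q})
    (Q0 : Q 0 = 0)
    (Q_gt0 : forall x, D x -> x != 0 -> 0 < Q x)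
    (W_posdef : posdefmx W)
    (mu_lip : forall i,
       [locally [lipschitz closed_loop f g (mu i) x | x in D]])
    (Omega0_compact : compact (Omega 0%N))
    (mu0_admissible : admissible D f g Q W (mu 0%N) (Omega 0%N))
    (V_C1 : forall i, admissible D f g Q W (mu i) (Omega i) ->
       value_C1 D f g Q W (mu i) (Omega i))
    (improvement : forall i x, Omega i x ->
       mu i.+1 x =
       - 2^-1 *: (invmx W *m (g x)^T *m gradient (value D f g Q W (mu i)) x))
    (c_gt0 : forall i, 0 < c i)
    (update : forall i, Omega i.+1 = value_sublevel D f g Q W (mu i) (c i))
    (update_sub : forall i,
       value_sublevel D f g Q W (mu i) (c i) `<=` Omega i) :
  forall i,
    [/\ policy D (mu i.+1) (Omega i.+1),
        invariantly_admissible D f g Q W (mu i) (Omega i.+1) /\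
        invariantly_admissible D f g Q W (mu i.+1) (Omega i.+1) &
        (forall x, Omega i.+1 x -> forall j, (j <= i)%N ->
           value D f g Q W (mu j.+1) x <= value D f g Q W (mu j) x) /\
        (forall x, Omega i.+1 x -> x != 0 ->
           0 < value D f g Q W (mu i.+1) x)].
Proof.
have step i : admissible D f g Q W (mu i) (Omega i) -> compact (Omega i) -> _ :=
  fun adm cpt => improvement_step D_region f0 g_lip Q_cont Q0 Q_gt0 W_posdef
    (mu_lip i) (mu_lip i.+1) cpt adm (V_C1 i adm) (improvement i) (c_gt0 i)
    (update_sub i).
have inv i : admissible D f g Q W (mu i) (Omega i) /\ compact (Omega i).
  elim: i => [//|i [adm cpt]]; rewrite update.
  by have [? _ [_ [? _]] _ _] := step i adm cpt.
(* Step [j] compares the values of [mu j.+1] and [mu j] on [Omega j.+1] only; nesting of the regions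
   brings the points of [Omega i.+1] there for every [j <= i]. *)
have sub i j : (i <= j)%N -> Omega j `<=` Omega i.
  move=> /subnK <-; elim: (j - i)%N => [//|k ih].
  by rewrite addSn update; exact: subset_trans (update_sub _) ih.
move=> i; have [adm cpt] := inv i.
have [_ pol admuw _ gt0] := step i adm cpt.
rewrite update; split; [exact: pol|exact: admuw|split; last exact: gt0].
move=> x Kx j ji.
have [admj cptj] := inv j.
have [_ _ _ lej _] := step j admj cptj.
apply: lej; rewrite -update; apply: (sub j.+1 i.+1); first exact: ji.
by rewrite update.
Qed.
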